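(* Let $q\ge5$ be a prime power, $n,N$ divisors of $q-1$, $r$ a divisor of $\frac{q-1}{n}$ and $R$ a divisor of $\frac{q-1}{N}$. Let $f,F\in\mathbb{F}_q[x]$ be non-constant square-free polynomials with $f/F$ not constant, and let $D+1\ge2$ be the number of distinct roots of $f\cdot F$ in its splitting field over $\mathbb{F}_q$. Let $N_{f,F}$ be the number of $\theta\in\mathbb{F}_q$ such that $f(\theta)$ is $(r,n)$-free and $F(\theta)$ is $(R,N)$-free. Let $p_1,\dots,p_u$ be distinct primes dividing $r$ and $l_1,\dots,l_v$ distinct primes dividing $R$, and write $r^*=k_rp_1\cdots p_u$, $R^*=k_Rl_1\cdots l_v$ (with $p_i\nmid k_r$, $l_j\nmid k_R$). Set $\delta=1-\sum_{i=1}^u1/p_i-\sum_{i=1}^v1/l_i$ and suppose $\delta>0$. Then $$N_{f,F}\ge\delta\cdot\frac{\phi(k_r)\phi(k_R)}{k_rnk_RN}\left(q-D\,n\,N\,W(k_r)W(k_R)\left(\frac{u+v-1}{\delta}+2\right)q^{1/2}\right).$$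
   Context: For a positive integer $A$, $A^*$ denotes the product of the distinct primes dividing $A$. Freeness is taken in the cyclic group $\mathbb{F}_q^*$ of order $Q=q-1$ (so $0$ is never free). For a divisor $n$ of $Q$ and a divisor $r$ of $Q/n$, let $\mathcal C_{Q/n}$ be the subgroup of $\mathbb{F}_q^*$ of order $Q/n$; an element $h\in\mathbb{F}_q^*$ is called $(r,n)$-free if (i) $\mathrm{ord}(h)$ divides $Q/n$, and (ii) whenever $h=g^s$ with $g\in\mathcal C_{Q/n}$ and $s\mid r$, then $s=1$. $\phi$ is Euler's totient function and $W(a)$ is the number of square-free divisors of $a$. *)

(* Defs.v *)
From HB Require Import structures.
From mathcomp Require Import all_boot all_order all_algebra all_fingroup all_field.
Set Implicit Arguments. Unset Strict Implicit. Unset Printing Implicit Defensive.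
Import GRing.Theory Num.Theory.

Definition radn (A : nat) : nat := \prod_(p <- primes A) p.

Definition sqfreeb (d : nat) : bool := all (fun p => ~~ (p * p %| d)) (primes d).

Definition W (a : nat) : nat := count sqfreeb (divisors a).

Section Free.
Variable F : finFieldType.

Definition Qord : nat := #|F|.-1.

(* The subgroup C_m of F_q^* (for m | Q, the unique subgroup of order m,
   namely the elements whose m-th power is 1). *)
Definition Csub (m : nat) : {set {unit F}} := [set g : {unit F} | (g ^+ m == 1)%g].

Definition rn_free (r n : nat) (h : F) : bool :=
  match insub h : option {unit F} with
  | Some u =>
      (#[u]%g %| Qord %/ n) &&
      [forall g in Csub (Qord %/ n),
         forall s : 'I_r.+1, (s %| r) ==> (u == g ^+ s)%g ==> (val s == 1)]
  | None => false
  end.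

Definition NfF (r n R N : nat) (f G : {poly F}) : nat :=
  #|[set t : F | rn_free r n (f.[t])%R && rn_free R N (G.[t])%R]|.
End Free.

Definition sqfree_poly (K : fieldType) (p : {poly K}) : Prop :=
  forall g : {poly K}, (g ^+ 2 %| p)%R -> size g <= 1.

Definition nb_roots_in_splitting_field (K : fieldType) (p : {poly K}) (m : nat) : Prop :=
  exists (L : fieldExtType K),
    splittingFieldFor 1%VS (map_poly (in_alg L) p) fullv /\
    exists s : seq L, [/\ uniq s, size s = m &
       forall x : L, x \in s = root (map_poly (in_alg L) p) x].

(* Main.v *)
(* The counting function is expanded in multiplicative characters, so that everything
   rests on Weil's bound |sum_x chi(h(x))| <= (m - 1) sqrt q, where h has m distinct
   roots.  Over the extension of degree 2k, the number of x with h(x)^((t^2-1)/d) = z,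
   where t = q^k, is bounded by an auxiliary polynomial w in the manner of Stepanov and
   Bombieri: on these x, (h w)^t agrees with a polynomial of low degree, which is made
   identically zero by linear algebra, while w <> 0 because y^d = h(x) is irreducible.
   For the sums S_k over the extensions of degree k, this gives |S_(2k)| <= C q^k with a
   poor constant C.  On the other hand, the S_k are, up to sign, the power sums of the
   m - 1 inverse roots of an L-polynomial, whose coefficients are sums over monic
   polynomials and vanish from degree m on; the poor bound for all large k bounds each
   inverse root by sqrt q.

   The freeness indicator is a product of functions u_n (1 - u_(np)), where u_n is the
   indicator of the subgroup of order (q-1)/n; their Fourier coefficients have l1-norm
   2 (1 - 1/p), which yields the factors W(k_r) phi(k_r)/k_r.  In the sieve step, the
   difference of the counts for p k_r and (1 - 1/p) times that for k_r has no main term,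
   and costs only a further factor 1 - 1/p. *)

Require Import Defs.
From HB Require Import structures.
From mathcomp Require Import all_boot all_order all_algebra all_fingroup all_field.
From mathcomp Require Import cyclic zify ring.
Import Order.TTheory.
Import GRing.Theory Num.Theory.
Local Open Scope ring_scope.
Set Implicit Arguments.
Unset Strict Implicit.
Unset Printing Implicit Defensive.

(** * The equation y^d = h(x) *)

(** No extension field is built: the field with q^k elements is the list of fixed points of x ->
    x^(q^k) in one algebraically closed [E], norms are products over Frobenius orbits, and values
    return to [F] through a partial inverse of the embedding. Even degree 2k makes the auxiliary
    polynomial work, since x^(t^2) = x lowers the degree of a t-th power; it is enough because the
    S_(2k) are the power sums of the squares of the inverse roots. Stepanov's method bounds each
    fibre only from above; as the fibres add up to nearly t^2 points, this controls deviations in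
    both directions. The vanishing of the high coefficients requires a multiplier on which the
    character is nontrivial; were there none, all nonzero terms of S_(2k) would coincide, and the
    same poor bound would fail. All characters are powers chi^k, k > 0, of one injective chi, so
    even the trivial one vanishes at 0. The main term thus loses the at most D + 1 zeros of the
    product of the two polynomials; the pair of trivial characters, to which Weil's bound is not
    applied, pays for them, as D + 1 <= D sqrt q. *)

Lemma char_poly_dvd_Xn_sub (k : fieldType) n (M : 'M[k]_n.+1) d (b : k) :
  char_poly M %| 'X^d - b%:P -> (\det M) ^+ d = b ^+ n.+1.
Proof.
case/dvdpP=> u defu.
have /eqP: horner_mx M ('X^d - b%:P) = 0 by rewrite defu rmorphM /= Cayley_Hamilton mulr0.
rewrite rmorphB rmorphXn /= horner_mx_X horner_mx_C subr_eq0 => /eqP Md.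
rewrite -[RHS]det_scalar -Md.
elim: d {u defu Md} => [|d IH]; first by rewrite !expr0 det1.
by rewrite !exprS det_mulmx IH.
Qed.

(** The product of the roots of a factor of degree s of X^d - b has d-th power b^s. The determinant
    of the companion matrix plays the part of this product, so that neither a splitting field nor a
    sign appears. *)
Lemma dvd_Xn_sub_norm (k : fieldType) (A : {poly k}) d (b : k) :
  (0 < d)%N -> A %| 'X^d - b%:P -> exists a, a ^+ d = b ^+ (size A).-1.
Proof.
move=> d0 Adv.
have A0 : A != 0.
  by apply: contraTneq Adv => ->; rewrite dvd0p monic_neq0 // monicXnsubC.
pose B := (lead_coef A)^-1 *: A.
have lA : (lead_coef A)^-1 != 0 by rewrite invr_eq0 lead_coef_eq0.
have mB : B \is monic by rewrite monicE lead_coefZ mulVf // lead_coef_eq0.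
have sB : size B = size A by rewrite size_scale.
have Bdv : B %| 'X^d - b%:P by rewrite dvdpZl.
rewrite -sB; move: (companionmx B) (companionmxK mB).
case: (size B).-1 => [|n] M defM; first by exists 1; rewrite expr1n expr0.
by exists (\det M); apply: char_poly_dvd_Xn_sub; rewrite defM.
Qed.

Lemma expr_frac_eq (k : fieldType) (n e c h : k) d s :
  e != 0 -> h != 0 -> (n / e) ^+ d = (c / h) ^+ s -> n ^+ d * h ^+ s = c ^+ s * e ^+ d.
Proof.
move=> e0 h0; rewrite !expr_div_n => /eqP; rewrite eqr_div ?expf_neq0 // => /eqP ->.
by [].
Qed.

Lemma fracP_exists (R : idomainType) (a : {fraction R}) :
  exists n e : R, e != 0 /\ a = FracField.tofrac n / FracField.tofrac e.
Proof.
elim/quotW: a => y; exists (\n_y), (\d_y); split; first exact: denom_ratioP.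
have d0 : FracField.tofrac (\d_y) != 0 by rewrite tofrac_eq0 denom_ratioP.
apply: (canRL (mulfK d0)); rewrite -[_ * _]/(FracField.mul _ _).
apply/eqP; rewrite !piE /FracField.mulf FracField.equivfE.
by rewrite !numden_Ratio ?(oner_eq0, mulf_neq0, denom_ratioP) // !mulr1 mulrC.
Qed.

Lemma tofrac_inj (R : idomainType) : injective (@FracField.tofrac R).
Proof. by move=> x y /eqP; rewrite tofrac_eq => /eqP. Qed.

Lemma mup_exp (K : fieldType) (u : {poly K}) x j : u != 0 -> mup x (u ^+ j) = (j * mup x u)%N.
Proof.
move=> u0; elim: j => [|j IH]; first by rewrite expr0 mupNroot // root1.
by rewrite exprS mupM ?expf_neq0 // IH mulSn.
Qed.

(* The hypothesis that no [h ^+ s], [0 < s < d], is a [d]-th power up to a constant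
   makes [h Z^d - c] irreducible: a proper factor of degree [s] has a norm [a] with
   [a ^+ d * h ^+ s = c ^+ s]. *)
Lemma Kummer_no_factor (K : fieldType) (h : {poly K}) (c : K) d (D : {poly {poly K}}) :
  (0 < d)%N -> h != 0 -> c != 0 ->
  (forall s, (0 < s < d)%N -> exists x, ~~ (d %| s * mup x h)%N) ->
  (1 < size D <= d)%N -> D %| h *: 'X^d - c%:P%:P -> False.
Proof.
move=> d0 h0 c0 np /andP[sD1 sDd] Ddv.
pose k := {fraction {poly K}}.
pose phi : {rmorphism {poly K} -> k} := @FracField.tofrac _.
have phi0 u : (phi u == 0) = (u == 0) by apply: tofrac_eq0.
pose A := map_poly phi D.
have sA : size A = size D by rewrite size_map_poly_id0 // phi0 lead_coef_eq0 -size_poly_gt0 ltnW.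
pose b := phi c%:P / phi h.
have hb : phi h *: ('X^d - b%:P) = map_poly phi (h *: 'X^d - c%:P%:P).
  rewrite rmorphB /= map_polyZ map_polyXn /= map_polyC /= scalerBr /b.
  by rewrite scale_polyC mulrC divfK ?phi0.
have Adv : A %| 'X^d - b%:P.
  have ph0 : phi h != 0 by rewrite phi0.
  rewrite -(dvdpZr _ _ ph0) hb /A; case/Pdiv.WeakIdomain.dvdpP: Ddv => [[w1 w2] /= w10 e].
  have pw0 : phi w1 != 0 by rewrite phi0.
  by rewrite -(dvdpZr _ _ pw0) -map_polyZ e rmorphM /= dvdp_mulIr.
have [a] := dvd_Xn_sub_norm d0 Adv.
rewrite sA; set s := (size D).-1 => ha.
have s_range : (0 < s < d)%N by rewrite /s; lia.
have [x] := np s s_range.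
have [n [e [e0 ae]]] := fracP_exists a.
have n0 : n != 0.
  apply: contraNneq c0 => n0; move: ha; rewrite ae n0 rmorph0 mul0r expr0n gtn_eqF //.
  by move/esym/eqP; rewrite expf_eq0 mulf_eq0 invr_eq0 !phi0 (negPf h0) orbF polyC_eq0 => /andP[].
have: n ^+ d * h ^+ s = (c ^+ s)%:P * e ^+ d.
  apply/eqP; rewrite -(inj_eq (tofrac_inj (R := {poly K}))); apply/eqP.
  rewrite !rmorphM !rmorphXn /=; move: ha; rewrite ae /b.
  by apply: expr_frac_eq; rewrite phi0.
(* Multiplicities at [x] give d mup(n) + s mup(h) = d mup(e), so [d] divides [s * mup x h]. *)
move=> /(congr1 (mup x)); have cs0 : c ^+ s != 0 by rewrite expf_neq0.
rewrite !mupM ?expf_neq0 ?polyC_eq0 // (@mupNroot _ x (_%:P)) ?rootC // add0n.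
rewrite !mup_exp // => E /negP; apply.
by rewrite -(dvdn_addr _ (dvdn_mulr (mup x n) (dvdnn d))) E dvdn_mulr.
Qed.

Lemma size_prod_le (K : fieldType) (I : finType) (F : I -> {poly K}) (e : I -> nat) :
  (forall i, size (F i) <= (e i).+1)%N ->
  (size (\prod_i F i)%R <= (\sum_i e i).+1)%N.
Proof.
move=> sF; apply: (leq_trans (size_poly_prod_leq _ _)).
have : (\sum_i size (F i) <= \sum_i (e i).+1)%N by apply: leq_sum.
have -> : (\sum_i (e i).+1 = \sum_i e i + #|I|)%N.
  by rewrite -sum1_card -big_split /=; apply: eq_bigr => i _; rewrite addn1.
have -> : #|(fun _ : I => true)| = #|I| by apply: eq_card.
lia.
Qed.

Lemma size_det_le (K : fieldType) n (M : 'M[{poly K}]_n) (e : 'I_n -> nat) :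
  (forall i j, size (M i j) <= (e i).+1)%N -> (size (\det M) <= (\sum_i e i).+1)%N.
Proof.
move=> sM; rewrite /determinant; apply: (leq_trans (size_sum _ _ _)).
apply/bigmax_leqP => s _; rewrite -signr_odd mulr_sign.
by case: ifP => _; rewrite ?size_polyN; apply: size_prod_le.
Qed.

(** With G = h^((t-1)/d), h G^d = h^t is congruent to c = h(a)^t modulo (X - a)^t, so Q = h Z^d - c
    also vanishes at G modulo (X - a)^t. The resultant of P and Q is then divisible by (X - a)^t,
    but its degree is at most d (B - 1) + (d - 1) deg h < t. It vanishes, and P shares a factor of
    degree less than d with the irreducible Q. *)
Lemma Kummer_indep (K : fieldType) (h : {poly K}) t d B (a : K) (P : {poly {poly K}}) :
  [pchar K].-nat t -> (0 < d)%N -> (d %| t.-1)%N -> h.[a] != 0 ->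
  (forall s, (0 < s < d)%N -> exists x, ~~ (d %| s * mup x h)%N) ->
  (size P <= d)%N -> (forall i, (size (P`_i)%R <= B)%N) ->
  (d * B + d.-1 * (size h).-1 <= t)%N ->
  ('X - a%:P) ^+ t %| P.[h ^+ (t.-1 %/ d)] -> P = 0.
Proof.
move=> tp d0 dt ha np sP sB tB dvP.
have h0 : h != 0 by apply: contraNneq ha => ->; rewrite horner0.
have t0 : (0 < t)%N by case/andP: tp.
set c := h.[a] ^+ t; have c0 : c != 0 by rewrite expf_neq0.
set G := h ^+ _ in dvP.
pose Q : {poly {poly K}} := h *: 'X^d - c%:P%:P.
have QG : Q.[G] = (h - h.[a]%:P) ^+ t.
  have tp' : [pchar {poly K}].-nat t.
    by move: tp; rewrite (eq_pnat _ (pchar_poly K)).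
  rewrite /Q hornerD hornerN hornerZ hornerXn hornerC /G -exprM divnK //.
  by rewrite -exprS prednK // exprDn_pchar // exprNn_pchar // polyC_exp.
have dvQ : ('X - a%:P) ^+ t %| Q.[G].
  by rewrite QG dvdp_exp2r // dvdp_XsubCl /root !hornerE subrr.
case: (eqVneq P 0) => // P0; exfalso.
have [i Pi0] : exists i, P`_i != 0 by exists (size P).-1; rewrite -lead_coefE lead_coef_eq0.
have B0 : (0 < B)%N by apply: leq_trans (sB i); rewrite size_poly_gt0.
have sQ : size Q = d.+1.
  have s1 : size (h *: 'X^d : {poly {poly K}}) = d.+1.
    by rewrite -mul_polyC size_Cmul // size_polyXn.
  rewrite /Q size_polyDl s1 // size_polyN.
  by apply: leq_ltn_trans (size_polyC_leq1 _) _.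
have sQi k : (size (Q`_k)%R <= size h)%N.
  have hp : (0 < size h)%N by rewrite size_poly_gt0.
  rewrite /Q coefB coefZ coefXn coefC.
  case: (eqVneq k d) => [->|_]; rewrite ?(gtn_eqF d0) ?mulr1 ?mulr0 ?subr0 ?sub0r //.
  by case: (k == 0)%N; rewrite size_polyN ?size_poly0 // size_polyC c0.
(* A constant [P] is excluded by its degree; the resultant lies in the ideal of [P] and [Q] when
   both have positive degree. *)
case: (leqP (size P) 1) => sP1.
  have /size_poly1P[] : size P == 1 by rewrite eqn_leq sP1 size_poly_gt0.
  move=> u u0 Pu; move: dvP; rewrite Pu hornerC => /(dvdp_leq u0).
  rewrite size_exp_XsubC ltnNge => /negP; apply.
  have := sB 0%N; rewrite Pu coefC /= => /leq_trans; apply.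
  apply: leq_trans tB; nia.
have [[u v] _ /= defR] : {uv : {poly {poly K}} * {poly {poly K}} | (size uv.1 < size Q /\ size uv.2 < size P)%N
  & (resultant P Q)%:P = uv.1 * P + uv.2 * Q} by apply: resultant_in_ideal; rewrite ?sQ.
have Rdv : ('X - a%:P) ^+ t %| resultant P Q.
  have := congr1 (fun p => p.[G]) defR; rewrite hornerC => ->.
  by rewrite hornerD !hornerM dvdp_add // dvdp_mull.
have : resultant P Q = 0.
  apply: contraTeq Rdv => R0; apply/negP => /(dvdp_leq R0).
  rewrite size_exp_XsubC ltnNge => /negP; apply.
  (* Degree bound per row of the Sylvester matrix: d rows hold coefficients of [P], the remaining
     ones coefficients of [Q]. *)
  pose e (i : 'I_((size Q).-1 + (size P).-1)) :=
    match split i with inl _ => B.-1 | inr _ => (size h).-1 end.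
  apply: (leq_trans (@size_det_le _ _ _ e _)).
    move=> k l; rewrite Sylvester_mxE /e; case: (split k) => j.
      by case: (j <= l)%N; rewrite ?mulr1n ?mulr0n ?size_poly0 // prednK.
    by case: (j <= l)%N; rewrite ?mulr1n ?mulr0n ?size_poly0 // prednK // size_poly_gt0.
  have -> : (\sum_i e i = (size Q).-1 * B.-1 + (size P).-1 * (size h).-1)%N.
    rewrite big_split_ord /=; congr (_ + _)%N.
      rewrite (eq_bigr (fun=> B.-1)) ?sum_nat_const ?card_ord // => k _.
      by rewrite /e; case: splitP => // k' /= E; have := ltn_ord k; rewrite E ltnNge leq_addr.
    rewrite (eq_bigr (fun=> (size h).-1)) ?sum_nat_const ?card_ord // => k _.
    by rewrite /e; case: splitP => // k' /= E; have := ltn_ord k'; rewrite -E ltnNge leq_addr.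
  rewrite sQ /=.
  have : ((size P).-1 * (size h).-1 <= d.-1 * (size h).-1)%N.
    by rewrite leq_mul2r; apply/orP; right; lia.
  have : (d * B.-1 + d = d * B)%N by rewrite -{2}(prednK B0) mulnS addnC.
  move: tB; move: (d * B)%N (d * B.-1)%N (d.-1 * _)%N ((size P).-1 * _)%N => *; lia.
move/eqP; rewrite resultant_eq0 => sD.
apply: (@Kummer_no_factor _ h c d (gcdp P Q)) => //; last exact: dvdp_gcdr.
rewrite sD /= (leq_trans _ sP) //; apply: dvdp_leq => //; exact: dvdp_gcdl.
Qed.

(** * The auxiliary polynomial *)

Lemma poly_lin_dep (K : fieldType) (T : finType) (f : T -> {poly K}) N :
  (forall i, size (f i) <= N)%N -> (N < #|T|)%N ->
  exists2 c : T -> K, exists i, c i != 0 & \sum_i c i *: f i = 0.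
Proof.
move=> sf NT; pose M := \matrix_(i < #|T|, j < N) (f (enum_val i))`_j.
have /rowV0Pn[v /sub_kermxP vM v0] : kermx M != 0.
  by rewrite kermx_eq0 -row_leq_rank -ltnNge (leq_ltn_trans (rank_leq_col _)).
exists (fun x => v 0 (enum_rank x)).
  by case/rV0Pn: v0 => i vi; exists (enum_val i); rewrite enum_valK.
apply/polyP=> j; rewrite coef0 coef_sum.
have [jN|Nj] := ltnP j N; last first.
  by rewrite big1 // => i _; rewrite coefZ nth_default ?mulr0 // (leq_trans (sf i)).
have /rowP/(_ (Ordinal jN)) := vM; rewrite !mxE; apply: etrans.
rewrite (reindex _ (onW_bij _ (enum_val_bij T))) /=.
by apply: eq_bigr => i _; rewrite coefZ enum_valK mxE.
Qed.

Lemma expr_sum_pchar (K : fieldType) (I : finType) (F : I -> K) t :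
  [pchar K].-nat t -> (\sum_i F i) ^+ t = \sum_i F i ^+ t.
Proof.
move=> tp; apply: (big_morph (fun x => x ^+ t)) => [x y|]; first exact: exprDn_pchar.
by case/andP: tp => t0 _; rewrite expr0n gtn_eqF.
Qed.

Lemma exprB_pchar (K : fieldType) (x y : K) t :
  [pchar K].-nat t -> (x - y) ^+ t = x ^+ t - y ^+ t.
Proof. by move=> tp; rewrite exprDn_pchar // exprNn_pchar. Qed.

Lemma sum_triple (R : nmodType) (I J L : finType) (f : I * J * L -> R) :
  \sum_x f x = \sum_j \sum_i \sum_l f (i, j, l).
Proof. by rewrite exchange_big !pair_bigA /=; apply: eq_bigr => -[[]]. Qed.

Section Stepanov.
Variables (K : closedFieldType) (h : {poly K}) (t d : nat) (z : K) (S : seq K).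
Hypotheses (tp : [pchar K].-nat t) (d0 : (0 < d)%N) (dt : (d %| t.-1)%N) (h0 : h != 0).
Hypothesis np : forall s, (0 < s < d)%N -> exists x, ~~ (d %| s * mup x h)%N.
Hypothesis uS : uniq S.
Hypothesis fixS : {in S, forall x, x ^+ (t * t) = x}.
Hypothesis valS : {in S, forall x, h.[x] ^+ ((t * t).-1 %/ d) = z}.
Hypothesis nzS : {in S, forall x, h.[x] != 0}.

Let m := (size h).-1.
Let e := (t.-1 %/ d)%N.

(** The polynomial is w = sum k_ijl X^l G^i (X - a)^(tj) with G = h^e. There are d J B unknowns, and
    the equations are the fewer coefficients of the low-degree polynomial that agrees with (h w)^t
    on [S]. The final bound is the degree of [w]. *)
Lemma stepanov_count B J a :
  h.[a] != 0 -> (d * B + d.-1 * m <= t)%N -> (t * B.-1 + m * t + J < d * J * B)%N ->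
  (size S <= B.-1 + m * e * d.-1 + t * J.-1)%N.
Proof.
move=> ha Bt count.
have t0 : (0 < t)%N by case/andP: tp.
have ed : (e * d = t.-1)%N by rewrite /e divnK.
have ie (i : 'I_d) : (i * e <= t)%N by apply: leq_trans (leq_pred t); rewrite -ed mulnC leq_mul2l ltnW ?orbT.
pose T := ('I_d * 'I_J * 'I_B)%type.
pose b := a ^+ (t * t).
(* The value of h^t times the t-th power of a basis term at a point y of [S]: y^(t^2) = y turns (y -
   a)^(tjt) into (y - b)^j, and h(y)^(e(t+1)) = z turns h(y)^(t + eit) into z^i h(y)^(t - ie). *)
pose f (x : T) := z ^+ x.1.1 *: ('X^(t * x.2) * h ^+ (t - x.1.1 * e) * ('X - b%:P) ^+ x.1.2).
have sizeX (u : {poly K}) k : (size (u ^+ k) <= (k * (size u).-1).+1)%N.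
  by rewrite mulnC; apply: size_poly_exp_leq.
have sf x : (size (f x) <= t * B.-1 + m * t + J)%N.
  case: x => [[i j] l]; rewrite /f /=.
  apply: leq_trans (size_scale_leq _ _) _.
  apply: leq_trans (size_polyMleq _ _) _; rewrite size_exp_XsubC.
  have := size_polyMleq ('X^(t * l)) (h ^+ (t - i * e)).
  rewrite size_polyXn; have := sizeX h (t - i * e)%N; rewrite -/m.
  have : ((t - i * e) * m <= m * t)%N by rewrite mulnC leq_mul2l leq_subr orbT.
  have : (t * l <= t * B.-1)%N by rewrite leq_mul2l; apply/orP; right; have := ltn_ord l; lia.
  have := ltn_ord j.
  move: (size ('X^(t * l) * h ^+ (t - i * e))) (size (h ^+ (t - i * e))) ((t - i * e) * m)%N (t * l)%N (m * t)%N (t * B.-1)%N; lia.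
have [|c [x0 cx0] csum] := poly_lin_dep sf.
  by rewrite !card_prod !card_ord.
(* The linear algebra yields the coefficients of w^t; those of [w] are their t-th roots in the
   closed field. *)
have root_t u : exists y : K, y ^+ t == u.
  have /closed_rootP[y] : size ('X^t - u%:P : {poly K}) != 1 by rewrite size_XnsubC // eqSS -lt0n.
  by rewrite rootE !hornerE subr_eq0; exists y.
pose k x := xchoose (root_t (c x)).
have kt x : k x ^+ t = c x by apply/eqP; apply: (xchooseP (root_t (c x))).
pose G := h ^+ e.
pose w : {poly K} := \sum_(x : T) k x *: ('X^(x.2) * G ^+ x.1.1 * ('X - a%:P) ^+ (t * x.1.2)).
have w_root : all (root w) S.
  apply/allP => y yS; have hz := valS yS.
  have q1 : ((t * t).-1 %/ d = e * t.+1)%N.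
    have -> : ((t * t).-1 = t.-1 * t.+1)%N by case: t t0 => //= n _; lia.
    by rewrite -ed mulnAC mulnK.
  rewrite q1 in hz.
  have hy := nzS yS.
  suff : h.[y] ^+ t * w.[y] ^+ t = 0.
    by move/eqP; rewrite mulf_eq0 !expf_eq0 t0 (negPf hy).
  have -> : h.[y] ^+ t * w.[y] ^+ t = (\sum_i c i *: f i).[y].
    rewrite /w !horner_sum expr_sum_pchar // mulr_sumr; apply: eq_bigr => -[[i j] l] _ /=.
    rewrite !hornerE !exprMn -!exprM kt.
    have -> : (y - a) ^+ (t * j * t) = (y - b) ^+ j.
      rewrite mulnAC exprM /b; congr (_ ^+ _).
      by rewrite exprM !exprB_pchar // -!exprM fixS.
    rewrite -hz -!exprM (mulnC t l) /=.
    have E : h.[y] ^+ (e * t.+1 * i) * h.[y] ^+ (t - i * e) = h.[y] ^+ t * h.[y] ^+ (e * i * t).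
      rewrite -!exprD; congr (_ ^+ _).
      have ie' : (e * i <= t)%N by rewrite mulnC.
      by rewrite mulnS mulnDl (mulnC i) addnAC subnKC // mulnAC.
    transitivity (h.[y] ^+ t * h.[y] ^+ (e * i * t) * (c (i, j, l) * y ^+ (l * t) * (y - b) ^+ j)).
      by ring.
    by rewrite -E; ring.
  by rewrite csum horner0.
pose Q i j : {poly K} := rVpoly (\row_(l < B) k (i, j, l)).
pose P (j : 'I_J) : {poly {poly K}} := rVpoly (\row_(i < d) Q i j).
have defw : w = \sum_j (P j).[G] * ('X - a%:P) ^+ (t * j).
  rewrite /w sum_triple.
  apply: eq_bigr => j _; rewrite (@horner_coef_wide _ d) ?size_poly // mulr_suml.
  apply: eq_bigr => i _; rewrite coef_rVpoly_ord mxE /Q /rVpoly poly_def !mulr_suml.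
  by apply: eq_bigr => l _; rewrite valK mxE !scalerAl.
have w0 : w != 0.
  apply: contraNneq cx0 => w0.
  (* Once the P_i with i < j vanish, w = 0 makes P_j(G) (X - a)^(tj) divisible by (X - a)^(t(j+1)),
     and [Kummer_indep] applies to P_j. *)
  have P0 : forall j : 'I_J, P j = 0.
    move=> [j]; elim/ltn_ind: j => j IH jJ; set j' := Ordinal jJ.
    apply: (@Kummer_indep _ h t d B a) => //; first exact: size_poly.
      move=> i; have [id|di] := ltnP i d; last by rewrite nth_default ?size_poly0 // (leq_trans (size_poly _ _)).
      by rewrite -[i]/(val (Ordinal id)) coef_rVpoly_ord mxE size_poly.
    have X0 : ('X - a%:P) ^+ (t * j) != 0 by rewrite expf_neq0 // polyXsubC_eq0.
    rewrite -(dvdp_mul2r _ _ X0) -exprD.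
    have := defw; rewrite w0 (bigD1 j') //= => /eqP; rewrite eq_sym addr_eq0 => /eqP ->.
    rewrite dvdpNr; apply: (big_ind (fun u => ('X - a%:P) ^+ (t + t * j) %| u)) => [|u v|i ij]; [exact: dvdp0 | exact: dvdp_add |].
    have [ltij|] := ltnP i j.
      by case: i ij ltij => i iJ ij /= /IH ->; rewrite horner0 mul0r dvdp0.
    rewrite leq_eqVlt eq_sym => /orP[E|ji]; first by case/negP: ij.
    by rewrite dvdp_mull // dvdp_exp2l // -mulnS leq_mul2l ji orbT.
  case: x0 => [[i j] l]; have := P0 j => /(congr1 (fun p : {poly {poly K}} => p`_i)).
  rewrite coef_rVpoly_ord coef0 mxE => /(congr1 (fun p : {poly K} => p`_l)).
  rewrite coef_rVpoly_ord coef0 mxE => kl.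
  by rewrite -kt kl expr0n gtn_eqF.
have := max_poly_roots w0 w_root uS.
have sw : (size w <= (B.-1 + m * e * d.-1 + t * J.-1).+1)%N.
  apply: leq_trans (size_sum _ _ _) _; apply/bigmax_leqP => -[[i j] l] _ /=.
  apply: leq_trans (size_scale_leq _ _) _.
  apply: leq_trans (size_polyMleq _ _) _; rewrite size_exp_XsubC.
  have := size_polyMleq ('X^l) (G ^+ i); rewrite size_polyXn /G -exprM.
  have := sizeX h (e * i)%N; rewrite -/m.
  have : (e * i * m <= m * e * d.-1)%N.
    rewrite mulnC mulnA leq_mul2l; apply/orP; right; have := ltn_ord i; lia.
  have : (t * j <= t * J.-1)%N by rewrite leq_mul2l; apply/orP; right; have := ltn_ord j; lia.
  have := ltn_ord l.
  move: (size ('X^l * h ^+ (e * i))) (size (h ^+ (e * i))) (e * i * m)%N (t * j)%N (t * J.-1)%N (m * e * d.-1)%N; lia.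
by move/leq_trans/(_ sw); rewrite ltnS.
Qed.

Lemma stepanov_bound :
  (((d.-1 * m + d) * m.+1 + m + 2) <= t)%N ->
  (d * size S <= t * t + d * (2 * m + 1) * t)%N.
Proof.
move=> tbig.
have [a ha] := closed_nonrootP _ h0.
have t0 : (0 < t)%N by case/andP: tp.
have ed : (e * d = t.-1)%N by rewrite /e divnK.
set m1 := (d.-1 * m)%N in tbig.
have m1t : (m1 + d <= t)%N.
  by apply: leq_trans tbig; rewrite -addnA mulnS -addnA leq_addr.
(* [B] is the largest value satisfying the degree condition. As dJ = t - 1 + d (m + 2), the unknowns
   beyond (t - 1) B number d (m + 2) B, about (m + 2) t; they cover the m t + J equations beyond t
   (B - 1), and the lower bound on [t] absorbs the rounding. *)
pose B := ((t - m1) %/ d)%N; pose J := (e + m + 2)%N.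
have B0 : (0 < B)%N by rewrite divn_gt0 //; lia.
have dB : (d * B <= t - m1)%N by rewrite mulnC leq_divM.
have dB' : (t - m1 < d * B + d)%N.
  by rewrite -mulnSr mulnC ltn_ceil.
have dJ : (d * J = t.-1 + d * (m + 2))%N by rewrite /J -addnA mulnDr (mulnC d e) ed.
have count : (t * B.-1 + m * t + J < d * J * B)%N.
  have h1 : ((t - m1 - d).+1 * m.+1 <= d * B * m.+1)%N by rewrite leq_mul2r; lia.
  have h2 : (t * m.+1 <= (t - m1 - d) * m.+1 + (m1 + d) * m.+1)%N.
    by rewrite -mulnDl leq_mul2r; lia.
  have h3 : (t * B.-1 + t = t * B)%N by rewrite -mulnSr prednK.
  have h4 : (d * J * B = t.-1 * B + d * B * m.+1 + d * B)%N.
    by rewrite dJ mulnDl -[RHS]addnA; congr (_ + _)%N; rewrite -mulnSr addn2 mulnAC.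
  have h5 : (t.-1 * B + B = t * B)%N by rewrite -mulSnr prednK.
  have h6 : (B <= d * B)%N by rewrite leq_pmull.
  have h7 : (e <= t.-1)%N by rewrite -ed leq_pmulr.
  rewrite h4 /J; rewrite mulSn in h1; rewrite mulnS (mulnC t m) in h2.
  move: h1 h2 h3 h5 h6 tbig.
  move: ((t - m1 - d) * m.+1)%N (d * B * m.+1)%N ((m1 + d) * m.+1)%N (t * B.-1)%N (t * B)%N (t.-1 * B)%N (d * B)%N (m * t)%N.
  lia.
have Bt : (d * B + m1 <= t)%N by lia.
have := stepanov_count ha Bt count.
rewrite -(leq_pmul2l d0) => /leq_trans; apply.
have J1 : (d * J.-1 = t.-1 + d * m.+1)%N.
  have -> : J.-1 = (e + m.+1)%N by rewrite /J; lia.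
  by rewrite mulnDr (mulnC d e) ed.
have k1 : (d * (m * e * d.-1) <= d * m * t)%N.
  have -> : (d * (m * e * d.-1) = m * d.-1 * t.-1)%N by rewrite -ed; ring.
  by rewrite leq_mul ?leq_pred // mulnC leq_mul2r leq_pred orbT.
have k2 : (d * (t * J.-1) = t.-1 * t + d * m.+1 * t)%N.
  by rewrite mulnCA J1 mulnC mulnDl.
have k3 : (t.-1 * t + t = t * t)%N by rewrite -mulSnr prednK.
have k4 : (d * B.-1 <= d * B)%N by rewrite leq_mul2l leq_pred orbT.
have k5 : (d * (2 * m + 1) * t = d * m * t + d * m.+1 * t)%N by ring.
rewrite k5 !mulnDr k2.
move: k1 k3 k4 dB; move: (d * (m * e * d.-1))%N (d * m * t)%N (d * B.-1)%N (t.-1 * t)%N (d * B)%N (t * t)%N; lia.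
Qed.

End Stepanov.

(** * Power sums *)

Lemma bernoulli (x : algC) k : 0 <= x -> 1 + x *+ k <= (1 + x) ^+ k.
Proof.
move=> x0; elim: k => [|k IH]; first by rewrite mulr0n addr0 expr0.
rewrite exprS mulrDl mul1r mulrS addrCA addrC.
apply: lerD IH _; rewrite -[leLHS]mulr1 ler_wpM2l //.
by apply: exprn_ege1; rewrite lerDl.
Qed.

(* Applying the shift polynomial [prod (X - y)], [y] ranging over the other elements
   of [s], to the sequence of power sums isolates the powers of a single element. *)
Lemma power_sum_bound (s : seq algC) (C B : algC) k0 :
  0 < B -> (forall k, (k0 <= k)%N -> `|\sum_(y <- s) y ^+ k| <= C * B ^+ k) ->
  forall z, z \in s -> `|z| <= B.
Proof.
move=> B0 sB z zs.
pose P : {poly algC} := \prod_(y <- s | y != z) ('X - y%:P).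
have Pz : P.[z] != 0.
  by rewrite /P -big_filter -rootE root_prod_XsubC mem_filter eqxx.
have Py y : y \in s -> y != z -> P.[y] = 0.
  move=> ys yz; apply/rootP; rewrite /P -big_filter root_prod_XsubC.
  by rewrite mem_filter yz.
have E k : \sum_(y <- s) y ^+ k * P.[y] = (z ^+ k * P.[z]) *+ count_mem z s.
  rewrite (bigID (pred1 z)) /= [X in _ + X]big1_seq ?addr0.
    by rewrite (eq_bigr (fun=> z ^+ k * P.[z])) ?big_const_seq ?iter_addr_0 // => i /eqP ->.
  by move=> y /andP[yz ys]; rewrite Py ?mulr0.
have E' k : \sum_(y <- s) y ^+ k * P.[y] = \sum_(j < size P) P`_j * \sum_(y <- s) y ^+ (k + j).
  under [RHS]eq_bigr do rewrite mulr_sumr.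
  rewrite exchange_big; apply: eq_bigr => y _ /=.
  rewrite horner_coef mulr_sumr; apply: eq_bigr => j _.
  by rewrite exprD mulrCA.
pose C1 := \sum_(j < size P) `|P`_j| * C * B ^+ j.
have bd k : (k0 <= k)%N -> `|z| ^+ k * `|P.[z]| <= C1 * B ^+ k.
  move=> kk; have cz : (0 < count_mem z s)%N by rewrite -has_count has_pred1.
  apply: (@le_trans _ _ `|(z ^+ k * P.[z]) *+ count_mem z s|).
    by rewrite normrMn normrM normrX -[leLHS]mulr1n ler_wpMn2l // mulr_ge0 ?exprn_ge0.
  rewrite -E E'; apply: (le_trans (ler_norm_sum _ _ _)); rewrite mulr_suml.
  apply: ler_sum => j _; rewrite normrM -mulrA -mulrA ler_wpM2l //.
  rewrite (mulrC (B ^+ j)) -exprD; apply: sB; lia.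
rewrite real_leNgt ?normr_real ?gtr0_real //; apply/negP => Bz.
have C10 : 0 <= C1.
  have := bd k0 (leqnn _); have Bk0 : 0 < B ^+ k0 by rewrite exprn_gt0.
  by rewrite -(pmulr_lge0 C1 Bk0); apply: le_trans; rewrite mulr_ge0 ?exprn_ge0.
(* If |z| > B, then (|z| / B)^k grows at least linearly in k, against [bd]. *)
pose x := `|z| / B - 1.
have x0 : 0 < x by rewrite subr_gt0 ltr_pdivlMr // mul1r.
pose M := C1 / `|P.[z]| / x.
have M0 : 0 <= M by rewrite !divr_ge0 // ltW.
pose k := (k0 + Num.bound M)%N.
have kM : M < k%:R.
  by apply: lt_le_trans (archi_boundP M0) _; rewrite ler_nat leq_addl.
have Pz0 : 0 < `|P.[z]| by rewrite normr_gt0.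
have Bk0 : 0 < B ^+ k by rewrite exprn_gt0.
have : x *+ k < C1 / `|P.[z]|.
  apply: (@lt_le_trans _ _ ((1 + x) ^+ k)).
    by apply: (lt_le_trans _ (bernoulli k (ltW x0))); rewrite ltrDr ltr01.
  rewrite ler_pdivlMr // -(ler_pM2r Bk0) mulrAC -exprMn.
  have -> : (1 + x) * B = `|z| by rewrite /x addrC subrK divfK // gt_eqF.
  exact: bd (leq_addr _ _).
rewrite -mulr_natl -ltr_pdivlMr // => /(lt_trans kM).
by rewrite ltxx.
Qed.

Lemma coef_prod_1sub (R : comNzRingType) (s : seq R) k :
  (\prod_(w <- s) (1 - w *: 'X) : {poly R})`_k =
  if (k <= size s)%N then (\prod_(w <- s) ('X - w%:P))`_(size s - k) else 0.
Proof.
elim: s k => [|w s IH] k.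
  by rewrite !big_nil !coef1 /=; case: k.
rewrite !big_cons mulrBl mul1r coefB -scalerAl coefZ coefXM mulrBl coefB coefXM coefCM /=.
rewrite !IH; case: k => [|k] /=.
  by rewrite !subn0 mulr0 subr0 /= [X in _ * X]nth_default ?mulr0 ?subr0 // size_prod_XsubC.
rewrite ltnS subSS; case: (ltngtP k (size s)) => [ks|ks|->]; [|by rewrite mulr0 subr0|by rewrite subnn].
by rewrite subn_eq0 leqNgt ks /= subnS.
Qed.

(** Newton's identities: the coefficients of E' = - (sum_i p_(i+1) X^i) E for E = prod (1 - w X) and
    p_i the power sums. The induction adds one root at a time. *)
Lemma newton_power_sums (R : comNzRingType) (s : seq R) k :
  \sum_(i < k) (\sum_(w <- s) w ^+ i.+1) * (\prod_(w <- s) (1 - w *: 'X) : {poly R})`_(k.-1 - i) =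
  - k%:R * (\prod_(w <- s) (1 - w *: 'X) : {poly R})`_k.
Proof.
elim: s k => [|w s IH] [|K].
- by rewrite big_ord0 oppr0 mul0r.
- by rewrite !big_nil coef1 mulr0 big1 // => i _; rewrite big_nil mul0r.
- by rewrite big_ord0 oppr0 mul0r.
pose E : {poly R} := \prod_(w <- s) (1 - w *: 'X).
have cE j : (\prod_(w <- w :: s) (1 - w *: 'X) : {poly R})`_j =
    E`_j - (if j is j'.+1 then w * E`_j' else 0).
  rewrite big_cons mulrBl mul1r coefB -scalerAl coefZ coefXM.
  by case: j => //=; rewrite mulr0.
pose G i := E`_(K - i) - (if (K - i)%N is j.+1 then w * E`_j else 0).
rewrite (eq_bigr (fun i : 'I_K.+1 => w ^+ i.+1 * G i + (\sum_(w <- s) w ^+ i.+1) * G i)); last first.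
  by move=> i _; rewrite cE big_cons mulrDl.
rewrite big_split /= cE /G {G}.
(* The sum telescopes: w^(i+1) E_(K-i) cancels against the subtracted part of the preceding term. *)
have e1 : \sum_(i < K.+1) w ^+ i.+1 * (E`_(K - i) - (if (K - i)%N is j.+1 then w * E`_j else 0)) = w * E`_K.
  elim: K {IH} => [|K IHK]; first by rewrite big_ord1 subr0 expr1.
  rewrite big_ord_recl /=.
  under eq_bigr do rewrite /bump /= add1n subSS exprS -mulrA.
  by rewrite -mulr_sumr IHK expr1; ring.
rewrite e1.
have := IH K.+1; have := IH K; rewrite -/E /= => I0 I1.
have -> : \sum_(i < K.+1) (\sum_(w <- s) w ^+ i.+1) * (E`_(K - i) - (if (K - i)%N is j.+1 then w * E`_j else 0)) = 
  - K.+1%:R * E`_K.+1 + w * (K%:R * E`_K).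
  under eq_bigr do rewrite mulrBr.
  rewrite sumrB I1; congr (_ + _); rewrite big_ord_recr /= subnn mulr0 addr0.
  rewrite -[K%:R]opprK mulNr -I0 mulrN mulr_sumr; congr (- _).
  apply: eq_bigr => -[i iK] _ /=.
  by rewrite mulrCA; case: K iK {e1 I0 I1} => // K iK /=; rewrite subSn.
by rewrite -!natr1; ring.
Qed.

(** The recurrence says that sum c_j X^j is the exponential of sum S_k X^k / k. Being a polynomial
    of degree at most n, it equals prod (1 - w X), where the w are the roots of the reversed
    polynomial, some of them 0 if the degree is less than n. As c_0 = 1, the recurrence determines
    S, and Newton's identities identify it. *)
Lemma newton_sequence (c S : nat -> algC) n :
  c 0%N = 1 -> (forall j, (n < j)%N -> c j = 0) ->
  (forall k, \sum_(i < k) S i.+1 * c (k.-1 - i)%N = k%:R * c k) ->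
  exists2 s : seq algC, size s = n & forall k, S k.+1 = - \sum_(w <- s) w ^+ k.+1.
Proof.
move=> c0 cn rec.
pose A := \poly_(j < n.+1) c (n - j)%N.
have [s defA] := closed_field_poly_normal A.
have sA : size A = n.+1 by rewrite size_poly_eq // subnn c0 oner_neq0.
have lA : lead_coef A = 1 by rewrite lead_coefE sA coef_poly ltnSn subnn c0.
rewrite lA scale1r in defA.
have ss : size s = n by move: sA; rewrite defA size_prod_XsubC => -[].
exists s => // k.
have cE j : c j = (\prod_(w <- s) (1 - w *: 'X) : {poly algC})`_j.
  rewrite coef_prod_1sub -defA ss; case: leqP => [jn|/cn //].
  by rewrite coef_poly ltnS leq_subr subKn.
elim/ltn_ind: k => k IH.
have := newton_power_sums s k.+1; rewrite -cE mulNr -rec.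
rewrite !big_ord_recr /= subnn -cE c0 !mulr1 opprD => /esym.
rewrite (eq_bigr (fun i : 'I_k => - ((\sum_(w <- s) w ^+ i.+1) * c (k - i)%N))); last first.
  by move=> i _; rewrite IH // mulNr.
rewrite sumrN opprK; under [in X in _ = X -> _]eq_bigr do rewrite -cE.
by move/addrI => <-; rewrite opprK.
Qed.

(* An eventual bound on the even power sums bounds the roots, hence the first sum. *)
Lemma newton_sequence_bound (c S : nat -> algC) n q C k0 :
  (0 < q)%N ->
  c 0%N = 1 -> (forall j, (n < j)%N -> c j = 0) ->
  (forall k, \sum_(i < k) S i.+1 * c (k.-1 - i)%N = k%:R * c k) ->
  (forall k, (k0 <= k)%N -> `|S (2 * k)%N| <= C * q%:R ^+ k) ->
  `|S 1%N| <= n%:R * sqrtC q%:R.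
Proof.
move=> q0 c0 cn rec bd; have [s ss Ss] := newton_sequence c0 cn rec.
rewrite Ss normrN; apply: (le_trans (ler_norm_sum _ _ _)).
have wb w : w \in s -> `|w| <= sqrtC q%:R.
  move=> ws; rewrite -(ler_pXn2r (n := 2)) ?nnegrE ?sqrtC_ge0 ?ler0n // sqrtCK -normrX.
  (* The power sums of the squares are the even ones. Starting at [k0.+1] leaves out the exponent 0,
     where [S] is not tied to the roots. *)
  apply: (@power_sum_bound [seq x ^+ 2 | x <- s] C q%:R k0.+1); rewrite ?ltr0n //; last exact: map_f.
  move=> [|k] // kk; have := bd k.+1 (ltnW kk).
  rewrite (_ : 2 * k.+1 = (2 * k).+1.+1)%N ?Ss; last by lia.
  rewrite normrN big_map; apply: le_trans; rewrite le_eqVlt; apply/orP; left; apply/eqP.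
  congr `|_|; apply: eq_bigr => x _; rewrite -exprM; congr (_ ^+ _); lia.
rewrite -ss -[size s]sum1_size natr_sum mulr_suml !big_seq; apply: ler_sum => w ws.
by rewrite expr1 mul1r wb.
Qed.

(** * Frobenius and values of polynomials at roots *)

Section Frobenius.
Variables (F : finFieldType) (E : closedFieldType) (iota : {rmorphism F -> E}).
Let q := #|F|.

Lemma card_field_gt1 : (1 < q)%N. Proof. exact: finNzRing_gt1. Qed.
Let q0 : (0 < q)%N. Proof. exact: ltnW card_field_gt1. Qed.

Lemma pchar_nat_card k : [pchar E].-nat (q ^ k)%N.
Proof.
have [p p_pr pF] := finPcharP F.
have pE : p \in [pchar E] by rewrite (fmorph_pchar iota).
rewrite pnatX (eq_pnat _ (pcharf_eq pE)); apply/orP; left.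
by rewrite /q -cardsT; exact: pprimeChar_pgroup pF.
Qed.

Lemma frobenius_rmorphism k : exists phi : {rmorphism E -> E}, forall x, phi x = x ^+ (q ^ k).
Proof.
have [p p_pr pF] := finPcharP F.
have pE : p \in [pchar E] by rewrite (fmorph_pchar iota).
have : p.-nat (q ^ k)%N by rewrite -(eq_pnat _ (pcharf_eq pE)) pchar_nat_card.
case/p_natP => n ->; elim: n => [|n [phi IH]]; first by exists idfun => x; rewrite expn0 expr1.
exists (pFrobenius_aut pE \o phi) => x.
by rewrite /= IH pFrobenius_autE -exprM expnSr.
Qed.

(** X^q - X is the product of the X - y for y in [F], so it has no further root in [E]. *)
Lemma fixed_in_range x : x ^+ q = x -> exists y, x = iota y.
Proof.
move=> xq; have := finField_genPoly F => /(congr1 (map_poly iota)).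
rewrite rmorphB /= map_polyXn map_polyX rmorph_prod /=.
move/(congr1 (fun p => root p x)); rewrite {1}rootE !hornerE xq subrr eqxx.
rewrite (eq_bigr (fun y => 'X - (iota y)%:P)); last by move=> y _; rewrite map_polyXsubC.
rewrite -(big_map iota xpredT (fun y => 'X - y%:P)) root_prod_XsubC => /esym/mapP[y _ ->].
by exists y.
Qed.

Lemma range_fixed y : (iota y) ^+ q = iota y.
Proof. by rewrite -rmorphXn /= expf_card. Qed.

(* The partial inverse of [iota]; the junk value is [0]. *)
Definition down (y : E) : F := odflt 0 [pick x | iota x == y].

Lemma iotaK : cancel iota down.
Proof.
move=> x; rewrite /down; case: pickP => [z /eqP /fmorph_inj //|/(_ x)].
by rewrite eqxx.
Qed.

Lemma downK y : y ^+ q = y -> iota (down y) = y.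
Proof. by move=> /fixed_in_range[x ->]; rewrite iotaK. Qed.

Lemma frob_inj k : injective (fun x : E => x ^+ (q ^ k)).
Proof.
have [phi phiE] := frobenius_rmorphism k.
by move=> x y; rewrite -!phiE => /fmorph_inj.
Qed.

Lemma frob_horner (h : {poly F}) x k :
  (map_poly iota h).[x] ^+ (q ^ k) = (map_poly iota h).[x ^+ (q ^ k)].
Proof.
have [phi phiE] := frobenius_rmorphism k.
rewrite -!phiE -horner_map -map_poly_comp; congr (_.[_]).
apply: eq_map_poly => y /=; rewrite phiE.
by elim: k {phi phiE} => [|k IH]; rewrite ?expn0 ?expr1 // expnSr exprM IH range_fixed.
Qed.

Lemma map_down (p : {poly E}) :
  (forall i, p`_i ^+ q = p`_i) -> map_poly iota (map_poly down p) = p.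
Proof.
have d0 : down 0 = 0 by rewrite -[X in down X](rmorph0 iota) iotaK.
by move=> pq; apply/polyP=> i; rewrite coef_map /= coef_map_id0 // downK.
Qed.

(** The subfield of order q^k of [E], as a list; it stands for the extension of degree k. *)
Definition fixseq k : seq E := sval (closed_field_poly_normal ('X^(q ^ k) - 'X)).

Lemma fixseqP k : (0 < k)%N ->
  [/\ uniq (fixseq k), size (fixseq k) = (q ^ k)%N & forall x, (x \in fixseq k) = (x ^+ (q ^ k) == x)].
Proof.
move=> k0; rewrite /fixseq; case: closed_field_poly_normal => s /= defP.
have qk1 : (1 < q ^ k)%N by rewrite -(exp1n k) ltn_exp2r ?card_field_gt1.
have sP : size ('X^(q ^ k) - 'X : {poly E}) = (q ^ k).+1.
  by rewrite size_polyDl ?size_polyXn // size_polyN size_polyX ltnS.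
have lP : lead_coef ('X^(q ^ k) - 'X : {poly E}) = 1.
  by rewrite lead_coefDl ?lead_coefXn // size_polyXn size_polyN size_polyX ltnS.
rewrite lP scale1r in defP.
have sepP : separable_poly ('X^(q ^ k) - 'X : {poly E}).
  rewrite separable_poly.unlock derivB derivXn derivX.
  have -> : 'X^((q ^ k).-1) *+ (q ^ k) = 0 :> {poly E}.
    apply/eqP; rewrite -mulr_natr mulf_eq0; apply/orP; right.
    rewrite -polyC_natr polyC_eq0; case/andP: (pchar_nat_card k) => _.
    have [p p_pr pF] := finPcharP F.
    have pE : p \in [pchar E] by rewrite (fmorph_pchar iota).
    move=> _; rewrite -(dvdn_pcharf pE).
    have := pchar_nat_card k; rewrite (eq_pnat _ (pcharf_eq pE)) => /p_natP[[|n] E1].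
      by rewrite E1 in qk1.
    by rewrite E1 dvdn_exp.
  by rewrite sub0r coprimep_sym -scaleN1r coprimepZl ?oppr_eq0 ?oner_eq0 // coprime1p.
split.
- by rewrite -separable_prod_XsubC -defP.
- by move: sP; rewrite defP size_prod_XsubC => -[].
- by move=> x; rewrite -root_prod_XsubC -defP rootE !hornerE subr_eq0.
Qed.

Definition rts (g : {poly F}) : seq E := sval (closed_field_poly_normal (map_poly iota g)).

Lemma rtsP g : map_poly iota g = iota (lead_coef g) *: \prod_(x <- rts g) ('X - x%:P).
Proof.
by rewrite /rts; case: closed_field_poly_normal => s /= {1}->; rewrite lead_coef_map.
Qed.

Lemma rts_perm g s c : g != 0 -> map_poly iota g = c *: \prod_(x <- s) ('X - x%:P) ->
  perm_eq (rts g) s.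
Proof.
move=> g0 gs; apply: prod_XsubC_eq.
have c_eq : c = iota (lead_coef g).
  rewrite -lead_coef_map gs lead_coefZ (eqP (monic_prod_XsubC _ _ _)) ?mulr1 //.
have l0 : iota (lead_coef g) != 0 by rewrite fmorph_eq0 lead_coef_eq0.
by apply: (scalerI l0); rewrite -rtsP gs c_eq.
Qed.

Lemma mem_rts g x : g != 0 -> (x \in rts g) = root (map_poly iota g) x.
Proof.
by move=> g0; rewrite rtsP rootZ ?fmorph_eq0 ?lead_coef_eq0 // root_prod_XsubC.
Qed.

Lemma size_rts g : g != 0 -> size (rts g) = (size g).-1.
Proof.
move=> g0; rewrite -(size_map_poly iota) rtsP size_scale ?size_prod_XsubC //.
by rewrite fmorph_eq0 lead_coef_eq0.
Qed.

Lemma rtsM g1 g2 : g1 != 0 -> g2 != 0 -> perm_eq (rts (g1 * g2)) (rts g1 ++ rts g2).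
Proof.
move=> g10 g20; apply: (@rts_perm _ _ (iota (lead_coef g1) * iota (lead_coef g2))).
  by rewrite mulf_neq0.
by rewrite rmorphM /= {1}(rtsP g1) {1}(rtsP g2) big_cat -scalerAl -scalerAr scalerA.
Qed.

Lemma rts_frob g k : g != 0 -> perm_eq (rts g) [seq x ^+ (q ^ k) | x <- rts g].
Proof.
move=> g0; have [phi phiE] := frobenius_rmorphism k.
apply: (@rts_perm _ _ (iota (lead_coef g))) => //.
have iq y : phi (iota y) = iota y.
  rewrite phiE; elim: k {phi phiE} => [|k IH]; first by rewrite expn0 expr1.
  by rewrite expnSr exprM IH range_fixed.
have -> : map_poly iota g = map_poly phi (map_poly iota g).
  by rewrite -map_poly_comp; apply: eq_map_poly => y /=; rewrite iq.
rewrite {1}rtsP map_polyZ iq rmorph_prod big_map; congr (_ *: _).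
by apply: eq_bigr => x _; rewrite /= map_polyXsubC /= phiE.
Qed.

(* For monic [g], the resultant of [g] and [h]. *)
Definition valprod (h g : {poly F}) : F := down (\prod_(x <- rts g) (map_poly iota h).[x]).

(** Frobenius permutes the roots of [g] with their multiplicities, so it fixes the product, which
    therefore lies in [F]. *)
Lemma iota_valprod h g : g != 0 -> iota (valprod h g) = \prod_(x <- rts g) (map_poly iota h).[x].
Proof.
move=> g0; apply: downK; rewrite -prodrXl [RHS](perm_big _ (rts_frob 1 g0)) big_map.
by apply: eq_bigr => x _; rewrite -{1}[q]expn1 frob_horner.
Qed.

Lemma valprod_mulr h g1 g2 : g1 != 0 -> g2 != 0 -> valprod h (g1 * g2) = valprod h g1 * valprod h g2.
Proof.
move=> g10 g20; apply: (fmorph_inj iota); rewrite rmorphM /= !iota_valprod ?mulf_neq0 //.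
by rewrite (perm_big _ (rtsM g10 g20)) big_cat.
Qed.

Lemma valprod_mull h1 h2 g : g != 0 -> valprod (h1 * h2) g = valprod h1 g * valprod h2 g.
Proof.
move=> g0; apply: (fmorph_inj iota); rewrite rmorphM /= !iota_valprod // -big_split.
by apply: eq_bigr => x _; rewrite rmorphM hornerM.
Qed.

Lemma valprod_eq0 h g : g != 0 -> (valprod h g == 0) = has (root (map_poly iota h)) (rts g).
Proof.
move=> g0; rewrite -(fmorph_eq0 iota) iota_valprod // prodf_seq_eq0.
by apply: eq_has => x; rewrite rootE.
Qed.

(** Reciprocity of the resultant: both sides are products of differences of a root of [g] and a root
    of [h]. For fixed [h] it shows that the left side depends on the monic [g] only through its
    degree and its values at the roots of [h]. *)
Lemma valprod_swap h g : h != 0 -> g \is monic ->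
  valprod h g = (lead_coef h * (-1) ^+ (size h).-1) ^+ (size g).-1 * valprod g h.
Proof.
move=> h0 mg; have g0 := monic_neq0 mg; apply: (fmorph_inj iota).
rewrite rmorphM rmorphXn rmorphM rmorphXn rmorphN1 /= !iota_valprod //.
rewrite -(size_rts g0) -(size_rts h0).
have hE x : (map_poly iota h).[x] = iota (lead_coef h) * \prod_(y <- rts h) (x - y).
  rewrite {1}rtsP hornerZ horner_prod; congr (_ * _).
  by apply: eq_bigr => y _; rewrite !hornerE.
have gE x : (map_poly iota g).[x] = \prod_(y <- rts g) (x - y).
  rewrite {1}rtsP (eqP mg) rmorph1 scale1r horner_prod.
  by apply: eq_bigr => y _; rewrite !hornerE.
under eq_bigr do rewrite hE.
under [X in _ = _ * X]eq_bigr do rewrite gE.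
rewrite big_split /= exprMn -mulrA; congr (_ * _).
  by rewrite big_const_seq count_predT iter_mulr_1.
rewrite -exprM mulnC exprM exchange_big /= -[in X in X * _](count_predT (rts h)).
rewrite -iter_mulr_1 -big_const_seq -big_split /=; apply: eq_bigr => y _.
rewrite -(count_predT (rts g)) -iter_mulr_1 -big_const_seq -big_split /=.
by apply: eq_bigr => x _; rewrite mulN1r opprB.
Qed.

End Frobenius.

(** * Frobenius orbits and divisors of a polynomial *)

(** The row of lower coefficients makes the monic polynomials of degree k a finite type to sum
    over. *)
Definition monicpoly (R : nzRingType) k (v : 'rV[R]_k) : {poly R} := 'X^k + rVpoly v.

Section MonicPoly.
Variable F : fieldType.

Lemma monicpolyP k (v : 'rV[F]_k) :
  monicpoly v \is monic /\ size (monicpoly v) = k.+1.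
Proof.
have sv : (size (rVpoly v) < size ('X^k : {poly F}))%N by rewrite size_polyXn ltnS size_poly.
by rewrite monicE /monicpoly lead_coefDl // lead_coefXn size_polyDl // size_polyXn.
Qed.

Definition lowrow k (p : {poly F}) : 'rV[F]_k := poly_rV (p - 'X^k).

Lemma monicpolyK k : cancel (@monicpoly F k) (@lowrow k).
Proof. by move=> v; rewrite /lowrow /monicpoly addrC addKr rVpolyK. Qed.

Lemma lowrowK k (p : {poly F}) : p \is monic -> size p = k.+1 -> monicpoly (lowrow k p) = p.
Proof.
move=> mp sp.
have sq : (size (p - 'X^k)%R <= k)%N.
  apply/leq_sizeP => j kj; rewrite coefB coefXn.
  move: kj; rewrite leq_eqVlt => /orP[/eqP <-|kj].
    by rewrite eqxx; have /monicP := mp; rewrite lead_coefE sp /= => ->; rewrite subrr.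
  by rewrite gtn_eqF // subr0 nth_default // sp.
by rewrite /monicpoly /lowrow (poly_rV_K sq) addrC subrK.
Qed.

End MonicPoly.

Lemma sum_monic_multiples (F : finFieldType) (R : nmodType) k m (C : {poly F}) (f : {poly F} -> R) :
  C \is monic -> size C = m.+1 -> (m <= k)%N ->
  \sum_(v : 'rV[F]_(k - m)) f (C * monicpoly v) =
  \sum_(v : 'rV[F]_k | C %| monicpoly v) f (monicpoly v).
Proof.
move=> mC sC mk; have C0 := monic_neq0 mC.
have CP (v : 'rV[F]_(k - m)) : monicpoly (lowrow k (C * monicpoly v)) = C * monicpoly v.
  have [mv sv] := monicpolyP v; apply: lowrowK; first by rewrite monicMl.
  by rewrite size_Mmonic ?monic_neq0 // sv sC; lia.
rewrite [RHS](reindex_onto (fun v : 'rV[F]_(k - m) => lowrow k (C * monicpoly v))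
  (fun v => lowrow (k - m) (monicpoly v %/ C))) /=.
  apply: eq_big => [v|v _]; last by rewrite CP.
  by rewrite CP dvdp_mulIl mulrC mulpK // monicpolyK eqxx.
move=> v Cv; have [mv sv] := monicpolyP v.
have mq : monicpoly v %/ C \is monic.
  by have := mv; rewrite -{1}(divpK Cv) monicMr.
have -> : monicpoly (lowrow (k - m) (monicpoly v %/ C)) = monicpoly v %/ C.
  by apply: lowrowK => //; rewrite size_divp // sv sC /= subSn.
by rewrite mulrC divpK // monicpolyK.
Qed.

Lemma prod_XsubC_exp_dvd (E : fieldType) (s : seq E) e (p : {poly E}) :
  uniq s -> (forall x, x \in s -> ('X - x%:P) ^+ e %| p) ->
  \prod_(x <- s) ('X - x%:P) ^+ e %| p.
Proof.
elim: s => [|x s IH] /=; first by rewrite big_nil dvd1p.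
case/andP=> xs us sp; rewrite big_cons Gauss_dvdp.
  rewrite sp ?mem_head //= IH // => y ys; apply: sp; by rewrite inE ys orbT.
rewrite big_seq; apply: (big_ind (fun u => coprimep _ u)) => [|u v cu cv|y ys].
- exact: coprimep1.
- by rewrite coprimepMr cu cv.
- rewrite coprimep_expl // coprimep_expr // coprimep_XsubC root_XsubC.
  by apply: contraNneq xs => <-.
Qed.

Lemma sum_count_mem (T : eqType) (s : seq T) : (\sum_(x <- undup s) count_mem x s = size s)%N.
Proof.
rewrite -[RHS](perm_size (perm_count_undup s)) size_flatten sumnE /shape -map_comp big_map.
by apply: eq_bigr => x _; rewrite /= size_nseq.
Qed.

Lemma sum_dvdn_le n mu k : (0 < n)%N ->
  (\sum_(i < k) ((n %| i.+1) && (i.+1 %/ n <= mu)) = minn mu (k %/ n))%N.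
Proof.
move=> n0; elim: k => [|k IH]; first by rewrite big_ord0 div0n minn0.
rewrite big_ord_recr /= IH divnS //; case: (n %| k.+1)%N => /=; last by rewrite addn0.
by case: leqP => /=; lia.
Qed.

Section OrbitCount.
Variables (F : finFieldType) (E : closedFieldType) (iota : {rmorphism F -> E}).
Let q := #|F|.

(* If [x] lies in the extension of degree [m] of [F], this is the characteristic
   polynomial of [x] over [F], i.e. a power of its minimal polynomial. *)
Definition orbit_poly m (x : E) : {poly E} := \prod_(j < m) ('X - (x ^+ (q ^ j))%:P).
Definition descent m x : {poly F} := map_poly (down iota) (orbit_poly m x).

Lemma orbit_poly_size m x : size (orbit_poly m x) = m.+1.
Proof. by rewrite /orbit_poly size_prod_XsubC /index_enum -enumT size_enum_ord. Qed.

(** When x^(q^m) = x, Frobenius permutes the factors cyclically, so the coefficients lie in [F]. *)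
Lemma map_descent m x : x ^+ (q ^ m) = x -> map_poly iota (descent m x) = orbit_poly m x.
Proof.
move=> xm; apply: map_down => i.
have [phi phiE] := frobenius_rmorphism iota 1.
rewrite expn1 in phiE; rewrite -phiE -coef_map; congr (_`_i).
rewrite /orbit_poly rmorph_prod /=.
under eq_bigr do rewrite map_polyXsubC /= phiE -exprM -expnSr.
case: m xm => [|m] xm; first by rewrite !big_ord0.
by rewrite big_ord_recr big_ord_recl /= xm expn0 expr1 mulrC.
Qed.

Lemma descent_monic m x : x ^+ (q ^ m) = x -> descent m x \is monic /\ size (descent m x) = m.+1.
Proof.
move=> xm; have := map_descent xm; split.
  by rewrite -(map_monic iota) map_descent // monic_prod_XsubC.
by rewrite -(size_map_poly iota) map_descent // orbit_poly_size.
Qed.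

Lemma expr_card_add (x : E) a b : x ^+ (q ^ (a + b)) = (x ^+ (q ^ a)) ^+ (q ^ b).
Proof. by rewrite expnD exprM. Qed.

Section Root.
Variables (g : {poly F}) (x : E).
Hypotheses (g0 : g != 0) (xg : x \in rts iota g).
Let mu := count_mem x (rts iota g).

Lemma count_frob j : count_mem (x ^+ (q ^ j)) (rts iota g) = mu.
Proof.
rewrite (seq.permP (rts_frob iota j g0)) count_map; apply: eq_count => y /=.
by apply: (inj_eq (@frob_inj _ _ iota j)).
Qed.

Lemma frob_period : exists n, (0 < n)%N && (x ^+ (q ^ n) == x).
Proof.
(* All conjugates of [x] are roots of [g], so two of the first [(size (rts iota g)).+1] coincide. *)
have : ~~ uniq (mkseq (fun j => x ^+ (q ^ j)) (size (rts iota g)).+1).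
  apply/negP => us; have /(uniq_leq_size us) : {subset mkseq (fun j => x ^+ (q ^ j)) (size (rts iota g)).+1 <= rts iota g}.
    by move=> y /mapP[j _ ->]; rewrite -has_pred1 has_count count_frob -has_count has_pred1.
  by rewrite size_mkseq ltnn.
case/(uniqPn x) => i [j [ij]]; rewrite size_mkseq => jk.
rewrite !nth_mkseq ?(ltn_trans ij jk) // => eij; exists (j - i)%N.
rewrite subn_gt0 ij; apply/eqP/(@frob_inj _ _ iota i).
by rewrite -expr_card_add subnK ?(ltnW ij).
Qed.

(** Here n is the degree of [x] over [F] and [orbit_poly n x] its minimal polynomial, of which the
    longer orbit products are powers. Conjugate roots of [g] have equal multiplicity, so the e-th
    power divides [g] exactly for e up to that multiplicity. *)
Lemma min_period : exists n, [/\ (0 < n)%N,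
    forall m, (x ^+ (q ^ m) == x) = (n %| m)%N,
    forall e, orbit_poly (n * e) x = orbit_poly n x ^+ e
  & forall e, (orbit_poly (n * e) x %| map_poly iota g) = (e <= mu)%N].
Proof.
case: (ex_minnP frob_period) => n /andP[n0 /eqP xn] nmin.
have xne e : x ^+ (q ^ (n * e)) = x.
  elim: e => [|e IH]; first by rewrite muln0 expn0 expr1.
  by rewrite mulnS expr_card_add xn.
have fixE m : (x ^+ (q ^ m) == x) = (n %| m)%N.
  rewrite {1}(divn_eq m n) mulnC expr_card_add xne /dvdn.
  have [r0|r0] := posnP (m %% n)%N; first by rewrite r0 expn0 expr1 eqxx.
  apply/negP => xr; have := ltn_pmod m n0.
  by rewrite ltnNge nmin // r0.
pose O := mkseq (fun j => x ^+ (q ^ j)) n.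
have uO : uniq O.
  apply/mkseq_uniqP => i j; rewrite !inE.
  wlog ij : i j / (i <= j)%N => [W|iN jN eij].
    by case/orP: (leq_total i j) => le ? ? ?; [|apply: esym]; apply: W.
  have : x ^+ (q ^ (j - i)) == x.
    by apply/eqP/(@frob_inj _ _ iota i); rewrite -expr_card_add subnK.
  rewrite fixE => /dvdn_leq; case: (posnP (j - i)%N) => [ji _|ji /(_ isT)]; first by lia.
  by move: jN; lia.
have orbn : orbit_poly n x = \prod_(y <- O) ('X - y%:P).
  by rewrite big_map -[X in seq.iota _ X]subn0 -/(index_iota 0 n) big_mkord.
have orbE e : orbit_poly (n * e) x = orbit_poly n x ^+ e.
  elim: e => [|e IH]; first by rewrite muln0 /orbit_poly big_ord0.
  rewrite mulnS exprS -IH /orbit_poly big_split_ord /=; congr (_ * _).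
  by apply: eq_bigr => j _; rewrite expr_card_add xn.
have l0 : iota (lead_coef g) != 0 by rewrite fmorph_eq0 lead_coef_eq0.
have XE y e : (('X - y%:P) ^+ e %| map_poly iota g) = (e <= count_mem y (rts iota g))%N.
  rewrite (rtsP iota g) dvdpZr // -mup_geq ?mu_prod_XsubC //.
  by rewrite monic_neq0 ?monic_prod_XsubC.
exists n; split=> // e; rewrite orbE orbn; apply/idP/idP => [|le_e].
  rewrite -XE; apply: dvdp_trans; apply: dvdp_exp2r.
  rewrite dvdp_XsubCl root_prod_XsubC; apply/mapP; exists 0%N; last by rewrite expn0 expr1.
  by rewrite mem_iota.
by rewrite -prodrXl prod_XsubC_exp_dvd // => y /mapP[j _ ->]; rewrite XE count_frob.
Qed.

Lemma orbit_count_root k : size g = k.+1 ->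
  (\sum_(i < k) ((x ^+ (q ^ i.+1) == x) && ((descent i.+1 x %| g)%R)) = mu)%N.
Proof.
move=> sg; have [n [n0 fixE _ dvE]] := min_period.
have gE0 : map_poly iota g != 0 by rewrite map_poly_eq0.
have nmu : (n * mu <= k)%N.
  have := leqnn mu; rewrite -dvE => /dvdp_leq => /(_ gE0).
  by rewrite orbit_poly_size size_map_poly sg.
rewrite (eq_bigr (fun i : 'I_k => ((n %| i.+1) && (i.+1 %/ n <= mu))%N : nat)); last first.
  move=> i _; rewrite fixE; case: (@dvdnP n i.+1) => //= -[e ie].
  rewrite -(dvdp_map iota) map_descent; last by apply/eqP; rewrite fixE ie dvdn_mull.
  by rewrite ie mulnC dvE mulKn.
rewrite sum_dvdn_le //; apply/minn_idPl; by rewrite leq_divRL // mulnC.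
Qed.

End Root.

(** A prime factor of degree n and multiplicity mu contributes n mu to the degree k: each of its n
    roots is counted in the degrees n, 2n, ..., n mu. This is the logarithmic derivative of the
    Euler product, read off at a single [g]. *)
Lemma orbit_count g k : g \is monic -> size g = k.+1 ->
  (\sum_(i < k) count (fun x => (descent i.+1 x %| g)%R) (fixseq F E i.+1) = k)%N.
Proof.
move=> mg sg; have g0 := monic_neq0 mg.
have sr : size (rts iota g) = k by rewrite size_rts // sg.
transitivity (\sum_(i < k) \sum_(x <- undup (rts iota g)) ((x ^+ (q ^ i.+1) == x) && ((descent i.+1 x %| g)%R)))%N.
  apply: eq_bigr => i _; have [uf _ memf] := @fixseqP _ _ iota i.+1 isT.
  rewrite -big_mkcond sum1_count -!size_filter; apply: perm_size.
  apply: uniq_perm; rewrite ?filter_uniq ?undup_uniq // => x.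
  rewrite !mem_filter mem_undup memf /=; apply/andP/andP => [[dv xi]|[/andP[xi dv] _]]; last by [].
  rewrite xi dv mem_rts //; split=> //; rewrite -dvdp_XsubCl.
  move: dv; rewrite -(dvdp_map iota) map_descent ?(eqP xi) //.
  by apply: dvdp_trans; rewrite /orbit_poly big_ord_recl expn0 expr1 dvdp_mulIl.
rewrite exchange_big -[RHS]sr -sum_count_mem !big_seq; apply: eq_bigr => x.
by rewrite mem_undup => xg /=; rewrite orbit_count_root.
Qed.

(** At a repeated root in [E] the square of the minimal polynomial of that root over [F] would
    divide [f]. *)
Lemma sqfree_rts_uniq (f : {poly F}) : f != 0 -> sqfree_poly f -> uniq (rts iota f).
Proof.
move=> f0 sqf; apply: count_mem_uniq => x; case: (boolP (x \in rts iota f)) => [xf|/count_memPn //].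
apply/eqP; rewrite eqn_leq -has_count has_pred1 xf andbT leqNgt; apply/negP => c2.
have [n [n0 fixE orbE dvE]] := min_period f0 xf.
have xn : x ^+ (q ^ n) = x by apply/eqP; rewrite fixE.
have := dvE 2%N; rewrite c2 orbE -map_descent // -rmorphXn /= dvdp_map => /sqf.
by have [_ ->] := descent_monic xn; rewrite leqNgt ltnS n0.
Qed.

End OrbitCount.

(** * The L-polynomial *)

Section LFunction.
Variables (F : finFieldType) (E : closedFieldType) (iota : {rmorphism F -> E}).
Variable chi : F -> algC.
Hypotheses (chi0 : chi 0 = 0) (chi1 : chi 1 = 1) (chiM : {morph chi : x y / x * y}).

Lemma chiX x n : chi (x ^+ n) = chi x ^+ n.
Proof. by elim: n => [|n IH]; rewrite ?expr0 // !exprS chiM IH. Qed.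

Variable h : {poly F}.
Hypothesis h0 : h != 0.
Let q := #|F|.

(* [Psum k] is the sum of [chi (N (h x))] over the extension of degree [k], [N] being the norm. *)
Definition Lcoef k : algC := \sum_(v : 'rV[F]_k) chi (valprod iota h (monicpoly v)).
Definition Psum k : algC := \sum_(x <- fixseq F E k) chi (valprod iota h (descent iota k x)).

Lemma Lcoef0 : Lcoef 0 = 1.
Proof.
rewrite /Lcoef (big_pred1 0) => [|v]; last by rewrite /= [v]thinmx0 eqxx.
have -> : monicpoly (0 : 'rV[F]_0) = 1 by rewrite /monicpoly linear0 addr0 expr0.
suff -> : valprod iota h 1 = 1 by rewrite chi1.
apply: (fmorph_inj iota); rewrite iota_valprod ?oner_neq0 // rmorph1.
suff -> : rts iota 1 = [::] by rewrite big_nil.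
by apply: size0nil; rewrite size_rts ?oner_neq0 // size_poly1.
Qed.

(** By multiplicativity, the i-th product is a sum over monic v of degree k and x in the extension
    of degree i + 1 whose characteristic polynomial divides v. After exchanging the sums,
    [orbit_count] shows that each v is counted k times. *)
Lemma Lcoef_newton k : \sum_(i < k) Psum i.+1 * Lcoef (k.-1 - i)%N = k%:R * Lcoef k.
Proof.
transitivity (\sum_(i < k) \sum_(x <- fixseq F E i.+1)
  \sum_(v : 'rV[F]_k | descent iota i.+1 x %| monicpoly v) chi (valprod iota h (monicpoly v))).
  apply: eq_bigr => i _; rewrite mulr_suml !big_seq; apply: eq_bigr => x.
  have [_ _ ->] := @fixseqP _ _ iota i.+1 isT => /eqP xi.
  have [mC sC] := descent_monic iota xi.
  rewrite -(sum_monic_multiples (fun p => chi (valprod iota h p)) mC sC) ?ltn_ord //.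
  rewrite /Lcoef mulr_sumr.
  have -> : (k.-1 - i = k - i.+1)%N by have := ltn_ord i; lia.
  apply: eq_bigr => v _; have [mv _] := monicpolyP v.
  by rewrite valprod_mulr ?monic_neq0 // chiM.
under eq_bigr do under eq_bigr do rewrite big_mkcond.
under eq_bigr do rewrite exchange_big.
rewrite exchange_big /Lcoef mulr_sumr; apply: eq_bigr => v _ /=.
have [mv sv] := monicpolyP v.
rewrite -[X in X%:R](orbit_count iota mv sv) natr_sum mulr_suml; apply: eq_bigr => i _.
by rewrite -big_mkcond /= big_const_seq iter_addr_0 mulr_natl.
Qed.

(* Multiplying the residues modulo [H] by a unit [u] permutes the monic polynomials
   of degree [j >= deg H], and multiplies their contributions by [chi (valprod u h)]. *)
Lemma Lcoef_eq0 (H u : {poly F}) :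
  H != 0 -> (forall x, root (map_poly iota h) x = root (map_poly iota H) x) ->
  chi (valprod iota u h) != 0 -> chi (valprod iota u h) != 1 ->
  forall j, ((size H).-1 <= j)%N -> Lcoef j = 0.
Proof.
move=> H0 hH cu0 cu1 j Hj.
have cu : coprimep u H.
  have Vu : valprod iota u h != 0 by apply: contraNneq cu0 => ->; rewrite chi0.
  rewrite -(coprimep_map iota) coprimep_sym; apply/coprimepP => d dH du.
  have nd : d != 0 by apply: contraTneq dH => ->; rewrite dvd0p map_poly_eq0.
  rewrite -size_poly_eq1; apply/negPn/negP => /closed_rootP[x dx].
  case/negP: Vu; rewrite valprod_eq0 //; apply/hasP; exists x; last by rewrite -dvdp_XsubCl (dvdp_trans _ du) // dvdp_XsubCl.
  by rewrite mem_rts // hH; rewrite -dvdp_XsubCl (dvdp_trans _ dH) // dvdp_XsubCl.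
pose c := chi (lead_coef h * (-1) ^+ (size h).-1).
have LE : Lcoef j = c ^+ j * \sum_(v : 'rV[F]_j) chi (valprod iota (monicpoly v) h).
  rewrite /Lcoef mulr_sumr; apply: eq_bigr => v _; have [mv sv] := monicpolyP v.
  by rewrite valprod_swap // sv chiM chiX.
rewrite LE; set s := \sum_v _; suff : s = chi (valprod iota u h) * s.
  move/eqP; rewrite -subr_eq0 -{1}[s]mul1r -mulrBl mulf_eq0 subr_eq0 eq_sym (negPf cu1) /=.
  by move/eqP->; rewrite mulr0.
(* [T] keeps the quotient by [H] and replaces the residue of v by that of u v; the condition deg H
   <= j protects the leading term. *)
pose T (v : 'rV[F]_j) : 'rV[F]_j :=
  lowrow j (monicpoly v + ((u * monicpoly v) %% H - monicpoly v %% H)).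
have sH : (0 < size H)%N by rewrite size_poly_gt0.
have sT v : (size ((u * monicpoly v) %% H - monicpoly v %% H)%R < j.+1)%N.
  rewrite ltnS (leq_trans _ Hj) // -ltnS prednK // (leq_ltn_trans (size_polyD _ _)) //.
  by rewrite gtn_max size_polyN !ltn_modp H0.
have TE v : monicpoly (T v) = monicpoly v + ((u * monicpoly v) %% H - monicpoly v %% H).
  have [mv sv] := monicpolyP v; apply: lowrowK.
    by rewrite monicE lead_coefDl ?sv ?sT //; apply/eqP/monicP.
  by rewrite size_polyDl sv ?sT.
have mm p : (p %% H) %% H = p %% H by rewrite modp_small // ltn_modp.
have Tmod v : monicpoly (T v) %% H = (u * monicpoly v) %% H.
  by rewrite TE modpD (modpD _ ((u * _) %% H)) modpN !mm addrCA subrr addr0.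
have Tinj : injective T.
  move=> v w Tvw; have E1 : monicpoly v %% H = monicpoly w %% H.
    apply/eqP; rewrite -subr_eq0 -modpN -modpD; apply: contraTT cu => nd; apply/negP => cu.
    case/negP: nd; apply/eqP/modp_eq0P; rewrite -(@Gauss_dvdpr _ _ u) 1?coprimep_sym //.
    by rewrite mulrBr; apply/modp_eq0P; rewrite modpD modpN -!Tmod Tvw subrr.
  have := congr1 (@monicpoly F j) Tvw; rewrite !TE E1 -!Tmod Tvw => /addIr.
  exact: (can_inj (@monicpolyK F j)).
rewrite {1}/s (reindex_inj Tinj) /= mulr_sumr; apply: eq_bigr => v _.
rewrite -chiM -valprod_mull //; congr (chi _); apply: (fmorph_inj iota); rewrite !iota_valprod //.
rewrite !big_seq; apply: eq_bigr => x; rewrite mem_rts // hH => /rootP Hx.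
rewrite (divp_eq (monicpoly (T v)) H) (divp_eq (u * monicpoly v) H) Tmod.
by rewrite !rmorphD !rmorphM /= !hornerD !hornerM Hx !mulr0 !add0r.
Qed.

End LFunction.

(** * Weil's bound *)

Lemma sum_fibers (T : finType) (A : eqType) (R : nmodType) (s : seq A) (w : A -> T)
    (P : pred T) (f : T -> R) :
  (forall x, x \in s -> P (w x)) ->
  \sum_(z | P z) f z *+ count (fun x => w x == z) s = \sum_(x <- s) f (w x).
Proof.
elim: s => [|x s IH] sP; first by rewrite big_nil big1.
rewrite big_cons -IH => [|y ys]; last by apply: sP; rewrite inE ys orbT.
under eq_bigr do rewrite /= mulrnDr.
rewrite big_split /= (bigD1 (w x)) ?sP ?mem_head //= eqxx mulr1n; congr (_ + _).
by rewrite big1 ?addr0 // => z /andP[_ zw]; rewrite eq_sym (negPf zw).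
Qed.

(** From |y| = 2 max(y, 0) - y: upper bounds on the terms of a sum, together with a lower bound on
    the sum, bound the sum of the absolute values. *)
Lemma normr_natB_le (a b c : nat) : (a <= b + c)%N ->
  `|a%:R - b%:R| <= (2 * c)%:R - (a%:R - b%:R) :> algC.
Proof.
move=> abc; case: (leqP a b) => ab.
  by rewrite distrC ger0_norm ?subr_ge0 ?ler_nat // opprB lerDr ler0n.
rewrite ger0_norm ?subr_ge0 ?ler_nat 1?ltnW // lerBrDr -natrB 1?ltnW // -natrD ler_nat; lia.
Qed.

Section Weil.
Variables (F : finFieldType) (E : closedFieldType) (iota : {rmorphism F -> E}).
Variable chi : F -> algC.
Hypotheses (chi0 : chi 0 = 0) (chi1 : chi 1 = 1) (chiM : {morph chi : x y / x * y}).
Hypothesis chi_inj : injective chi.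
Let q := #|F|.

Let chiX := chiX chi1 chiM.

Lemma chi_norm x : x != 0 -> `|chi x| = 1.
Proof.
move=> x0; have q1 : (0 < q.-1)%N by have := card_field_gt1 F; rewrite -/q; lia.
apply/eqP; rewrite -(pexpr_eq1 q1) // -normrX -chiX.
suff -> : x ^+ q.-1 = 1 by rewrite chi1 normr1.
by apply: (mulfI x0); rewrite -exprS prednK ?expf_card ?mulr1 // (ltnW (card_field_gt1 F)).
Qed.

Variables (h : {poly F}) (d e : nat).
Hypotheses (h0 : h != 0) (d1 : (1 < d)%N) (de : (d * e = q.-1)%N).
Hypothesis np : forall s, (0 < s < d)%N -> exists x, ~~ (d %| s * mup x (map_poly iota h))%N.

Let e0 : (0 < e)%N.
Proof. by have := card_field_gt1 F; rewrite -/q; case: e de => //; rewrite muln0; lia. Qed.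

(** The value is the norm of g(x), the product of its conjugates g(x)^(q^j). *)
Lemma iota_valprod_descent (g : {poly F}) k x : x ^+ (q ^ k) = x ->
  iota (valprod iota g (descent iota k x)) = (map_poly iota g).[x] ^+ (\sum_(j < k) q ^ j).
Proof.
move=> xk; have [mC _] := descent_monic iota xk; rewrite iota_valprod ?monic_neq0 //.
rewrite (perm_big [seq x ^+ (q ^ j) | j <- index_iota 0 k]) /=; last first.
  apply: (@rts_perm _ _ _ _ _ 1); rewrite ?monic_neq0 // map_descent // scale1r.
  by rewrite /orbit_poly big_map big_mkord.
rewrite big_map big_mkord expr_sum; apply: eq_bigr => j _.
by rewrite (frob_horner iota).
Qed.

Lemma sum_roots_of_unity : \sum_(z : F | z ^+ d == 1) chi z = 0.
Proof.
have [x x0 xe] : exists2 x : F, x != 0 & x ^+ e != 1.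
  apply/exists_inP; apply: contraT; rewrite negb_exists_in => /forall_inP H.
  have := @max_poly_roots _ ('X^e - 1 : {poly F}) (enum (predC1 0)).
  rewrite monic_neq0 ?monicXnsubC // enum_uniq => /(_ isT).
  have -> : all (root ('X^e - 1)) (enum (predC1 (0 : F))).
    apply/allP => x; rewrite mem_enum => x0; rewrite rootE !hornerE subr_eq0.
    by apply: contraNT (H x x0).
  move=> /(_ isT isT); rewrite size_XnsubC // -cardE cardC1 -/q -de ltnS.
  by rewrite leqNgt ltn_Pmull.
have xq : x ^+ (d * e) = 1.
  by rewrite de; apply: (mulfI x0); rewrite -exprS prednK ?expf_card ?mulr1 // (ltnW (card_field_gt1 F)).
have z0 : x ^+ e != 0 by rewrite expf_neq0.
set s := \sum_(z | _) _; suff E1 : s = chi (x ^+ e) * s.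
  move/eqP: E1; rewrite -subr_eq0 -{1}[s]mul1r -mulrBl mulf_eq0 subr_eq0 -chi1 => /orP[/eqP/chi_inj E1|/eqP //].
  by rewrite -E1 eqxx in xe.
rewrite {1}/s (reindex_inj (mulfI z0)) mulr_sumr /=.
by apply: eq_big => z; rewrite ?chiM // exprMn -exprM mulnC xq mul1r.
Qed.

Definition nonroots k := [seq x <- fixseq F E k | ~~ root (map_poly iota h) x].

Lemma size_nonroots k : (0 < k)%N -> (q ^ k <= size (nonroots k) + (size h).-1)%N.
Proof.
move=> k0; have [uf sf _] := @fixseqP _ _ iota k k0.
rewrite -sf -(count_predC (root (map_poly iota h)) (fixseq F E k)) addnC.
apply: leq_add; first by rewrite size_filter.
have := @max_poly_roots _ (map_poly iota h) [seq x <- fixseq F E k | root (map_poly iota h) x].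
rewrite map_poly_eq0 h0 filter_all filter_uniq // size_map_poly => /(_ isT isT isT).
by rewrite size_filter; case: (size h).
Qed.

Let m := (size h).-1.
Let C := (d * (2 * m + 1))%N.

(** Grouping by the value z of the norm of h^e, with z^d = 1, gives the sum of chi(z) N(z). Since
    the chi(z) add up to 0, t^2 / d may be subtracted from every N(z). Stepanov's bound is
    one-sided, but there are at most d values z and the N(z) add up to at least t^2 - m, so the
    deviations total O(t). *)
Lemma Psum_even_bound k : (((d.-1 * m + d) * m.+1 + m + 2) <= q ^ k)%N ->
  `|Psum iota chi (h ^+ e) (2 * k)| <= (2 * C + m)%:R * (q ^ k)%:R.
Proof.
set t := (q ^ k)%N => tbig.
have q1 := card_field_gt1 F; rewrite -/q in q1.
have k0 : (0 < k)%N.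
  by case: (posnP k) => // k0; move: tbig; rewrite /t k0 expn0; lia.
have tt : (q ^ (2 * k) = t * t)%N by rewrite mul2n -addnn expnD.
have dt : (d %| t.-1)%N by rewrite /t predn_exp -de -mulnA dvdn_mulr.
have tp : [pchar E].-nat t by apply: (pchar_nat_card iota).
have kk0 : (0 < 2 * k)%N by rewrite muln_gt0.
have [uf sf memf] := @fixseqP _ _ iota _ kk0.
pose w x := valprod iota (h ^+ e) (descent iota (2 * k) x).
(* The norm exponent (t^2 - 1) / (q - 1) times e = (q - 1) / d. *)
have wE x : x \in fixseq F E (2 * k) -> iota (w x) = (map_poly iota h).[x] ^+ ((t * t).-1 %/ d).
  rewrite memf => /eqP xk; rewrite /w iota_valprod_descent // rmorphXn /= horner_exp -exprM.
  by congr (_ ^+ _); rewrite -tt predn_exp -de -mulnA mulKn // ltnW.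
pose N z := count (fun x => w x == z) (nonroots (2 * k)).
have hfix x : x \in nonroots (2 * k) -> [/\ x \in fixseq F E (2 * k), (map_poly iota h).[x] != 0 & (w x) ^+ d == 1].
  rewrite mem_filter => /andP[hx xf]; split=> //.
  rewrite -(inj_eq (fmorph_inj iota)) rmorphXn rmorph1 /= wE // -exprM divnK; last first.
    by rewrite -tt predn_exp -de -mulnA dvdn_mulr.
  apply/eqP; have h0x : (map_poly iota h).[x] != 0 by [].
  apply: (mulfI h0x); rewrite -exprS prednK ?mulr1; last by rewrite -tt expn_gt0 ltnW.
  by rewrite -tt frob_horner; move: xf; rewrite memf => /eqP ->.
have NE z : (d * N z <= t * t + C * t)%N.
  rewrite /N -size_filter /C /m -(size_map_poly iota h).
  apply: (@stepanov_bound E (map_poly iota h) t d (iota z)) => //.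
  - exact: ltnW.
  - by rewrite map_poly_eq0.
  - by rewrite filter_uniq // filter_uniq.
  - move=> x; rewrite mem_filter => /andP[_ /hfix[xf _ _]].
    by apply/eqP; rewrite -tt -memf.
  - by move=> x; rewrite mem_filter => /andP[/eqP <- /hfix[xf _ _]]; rewrite wE.
  - by move=> x; rewrite mem_filter => /andP[_ /hfix[]].
  - by rewrite size_map_poly.
have PE : Psum iota chi (h ^+ e) (2 * k) = \sum_(z : F | z ^+ d == 1) chi z * (N z)%:R.
  transitivity (\sum_(x <- nonroots (2 * k)) chi (w x)).
    rewrite /nonroots big_filter /Psum [LHS](bigID (root (map_poly iota h))) /= big1_seq ?add0r //.
    move=> x /andP[/rootP hx xf]; rewrite -/(w x); suff -> : w x = 0 by [].
    apply: (fmorph_inj iota); rewrite wE // hx rmorph0 expr0n -tt predn_exp -de.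
    rewrite -mulnA mulKn ?(ltnW d1) // muln_eq0 (gtn_eqF e0) /=.
    by case: (2 * k)%N kk0 => // n _; rewrite big_ord_recl expn0.
  under [RHS]eq_bigr do rewrite mulr_natr.
  by rewrite sum_fibers // => x /hfix[].
have cardd : (#|[pred z : F | z ^+ d == 1%R]| <= d)%N.
  have := @max_poly_roots _ ('X^d - 1 : {poly F}) (enum [pred z : F | z ^+ d == 1]).
  have dp : (0 < d)%N by apply: ltnW.
  rewrite monic_neq0 ?monicXnsubC // enum_uniq size_XnsubC // -cardE ltnS.
  apply => //; apply/allP => x; rewrite mem_enum inE rootE !hornerE subr_eq0 //.
have sumN : (\sum_(z : F | z ^+ d == 1%R) N z = size (nonroots (2 * k)))%N.
  rewrite -sum1_size -(@sum_fibers _ _ nat _ w (fun z => z ^+ d == 1) (fun=> 1%N)).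
    by apply: eq_bigr => z _; rewrite natn.
  by move=> x /hfix[].
have dge : 0 < d%:R :> algC by rewrite ltr0n ltnW.
rewrite -(ler_pM2l dge) -[d%:R * `|_|]ger0_norm ?mulr_ge0 ?ler0n // normrM normr_id -normrM.
have -> : d%:R * Psum iota chi (h ^+ e) (2 * k) =
   \sum_(z : F | z ^+ d == 1) chi z * ((d * N z)%:R - (t * t)%:R).
  under [RHS]eq_bigr do rewrite mulrBr.
  rewrite sumrB -mulr_suml sum_roots_of_unity mul0r subr0 PE mulr_sumr.
  by apply: eq_bigr => z _; rewrite natrM mulrCA.
apply: (le_trans (ler_norm_sum _ _ _)).
apply: (@le_trans _ _ (\sum_(z : F | z ^+ d == 1) ((2 * C * t)%:R - ((d * N z)%:R - (t * t)%:R)))).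
  apply: ler_sum => z zd.
  have z0 : z != 0.
    by apply: contraTneq zd => ->; rewrite expr0n gtn_eqF ?(ltnW d1) // eq_sym oner_neq0.
  by rewrite normrM chi_norm // mul1r -mulnA; apply: normr_natB_le.
rewrite !sumrB -!natr_sum !sum_nat_const -big_distrr /= sumN.
rewrite opprB addrA -natrD lerBlDr -!natrM -natrD ler_nat.
have := size_nonroots kk0; rewrite -/m tt => snr.
have t0 : (0 < t)%N by rewrite /t expn_gt0 ltnW.
apply: (@leq_trans (d * (2 * C * t) + d * (t * t))%N).
  by apply: leq_add; rewrite leq_mul2r cardd orbT.
apply: (@leq_trans (d * (2 * C * t) + d * (size (nonroots (2 * k)) + m * t))%N).
  rewrite leq_add2l leq_mul2l (leq_trans snr) ?orbT // leq_add2l leq_pmulr //.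
by rewrite mulnDl !mulnDr -addnA leq_add2l addnC.
Qed.

(** The candidates for u are the characteristic polynomials of the x with h(x) != 0. If all of them
    gave 1, reciprocity would make every nonzero term of [Psum] of degree 2k the same number of
    modulus 1, so that its modulus would be at least q^(2k) - m, beyond the bound O(q^k). *)
Lemma exists_twist :
  exists2 u : {poly F}, chi (valprod iota u (h ^+ e)) != 0 & chi (valprod iota u (h ^+ e)) != 1.
Proof.
(* Since k < q^k, this k passes the threshold of [Psum_even_bound] and makes q^k exceed 2C + 2m. *)
pose k := ((d.-1 * m + d) * m.+1 + m + 2 + (2 * C + m + m + 1))%N.
have q1 := card_field_gt1 F; rewrite -/q in q1.
have kt : (k < q ^ k)%N by apply: ltn_expl.
have kk0 : (0 < 2 * k)%N by rewrite muln_gt0 /=; lia.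
have tt : (q ^ (2 * k) = q ^ k * q ^ k)%N by rewrite mul2n -addnn expnD.
have he0 : h ^+ e != 0 by rewrite expf_neq0.
have [uf sf memf] := @fixseqP _ _ iota _ kk0.
have rooth x : root (map_poly iota (h ^+ e)) x = root (map_poly iota h) x.
  by rewrite rmorphXn /= !rootE horner_exp expf_eq0 e0.
have [/hasP[x xn xc]|] := boolP (has (fun x => chi (valprod iota (descent iota (2 * k) x) (h ^+ e)) != 1) (nonroots (2 * k))).
  exists (descent iota (2 * k) x) => //.
  move: xn; rewrite mem_filter memf => /andP[hx /eqP xk].
  rewrite -chi0 (inj_eq chi_inj) valprod_eq0 //; apply/hasPn => y.
  rewrite mem_rts // rooth => hy; rewrite map_descent // /orbit_poly.
  rewrite rootE horner_prod; apply/prodf_neq0 => j _; rewrite !hornerE subr_eq0.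
  apply: contraNneq hx => xy.
  have := rootP hy; rewrite xy -frob_horner => /eqP; rewrite expf_eq0 rootE => /andP[].
  by [].
rewrite -all_predC => /allP allc.
pose c := chi (lead_coef (h ^+ e) * (-1) ^+ (size (h ^+ e)).-1).
have c1 : `|c| = 1.
  by rewrite /c chi_norm // mulf_neq0 ?lead_coef_eq0 // signr_eq0.
have PE : Psum iota chi (h ^+ e) (2 * k) = c ^+ (2 * k) * (size (nonroots (2 * k)))%:R.
  rewrite /Psum [LHS](bigID (root (map_poly iota h))) /= big1_seq ?add0r.
    rewrite -big_filter -/(nonroots _) -sum1_size natr_sum mulr_sumr !big_seq.
    apply: eq_bigr => x xn; have /= := allc x xn; rewrite negbK => /eqP E1.
    move: xn; rewrite mem_filter memf => /andP[hx /eqP xk].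
    have [mC sC] := descent_monic iota xk.
    by rewrite valprod_swap // chiM chiX E1 sC.
  move=> x /andP[hx xf]; suff -> : valprod iota (h ^+ e) (descent iota (2 * k) x) = 0 by [].
  move: xf; rewrite memf => /eqP xk; have [mC sC] := descent_monic iota xk.
  apply/eqP; rewrite valprod_eq0 ?monic_neq0 //; apply/hasP; exists x; last by rewrite rooth.
  rewrite mem_rts ?monic_neq0 // map_descent // /orbit_poly.
  by case: (2 * k)%N kk0 => // n _; rewrite big_ord_recl expn0 expr1 rootM root_XsubC eqxx.
have := @Psum_even_bound k; rewrite PE normrM normrX c1 expr1n mul1r normr_nat -natrM ler_nat.
have -> : (((d.-1 * m + d) * m.+1 + m + 2) <= q ^ k)%N.
  by apply: leq_trans (ltnW kt); rewrite /k leq_addr.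
move=> /(_ isT) bd; have := size_nonroots kk0; rewrite -/m tt => snr.
exfalso.
have k2 : (2 * C + m + m + 1 <= q ^ k)%N.
  by apply: leq_trans (ltnW kt); rewrite /k leq_addl.
have := leq_mul k2 (leqnn (q ^ k)); have t0 : (0 < q ^ k)%N by rewrite expn_gt0 ltnW.
have : (m <= m * q ^ k)%N by rewrite leq_pmulr.
rewrite !mulnDl mul1n; rewrite !mulnDl in bd.
rewrite mul0n in bd *; move: bd snr t0; move: (C * q ^ k)%N (m * q ^ k)%N (q ^ k * q ^ k)%N (q ^ k)%N (size _); lia.
Qed.

(** The L-polynomial has degree at most deg H - 1 for any [H] with the roots of [h]; a separable [H]
    gives the constant in terms of distinct roots. *)
Theorem weil_bound (H : {poly F}) :
  H != 0 -> (forall x, root (map_poly iota h) x = root (map_poly iota H) x) ->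
  `|\sum_(x : F) chi ((h ^+ e).[x])| <= ((size H).-2)%:R * sqrtC q%:R.
Proof.
move=> H0 hH; have he0 : h ^+ e != 0 by rewrite expf_neq0.
have [u u0 u1] := exists_twist.
have q1 := card_field_gt1 F; rewrite -/q in q1.
have rooth x : root (map_poly iota (h ^+ e)) x = root (map_poly iota H) x.
  by rewrite -hH rmorphXn /= !rootE horner_exp expf_eq0 e0.
have -> : \sum_(x : F) chi ((h ^+ e).[x]) = Psum iota chi (h ^+ e) 1.
  have [uf sf memf] := @fixseqP _ _ iota 1 isT.
  rewrite /Psum [RHS](perm_big [seq iota x | x <- enum F]) /=; last first.
    apply: uniq_perm => // [|x]; first by rewrite map_inj_uniq ?enum_uniq //; apply: fmorph_inj.
    rewrite memf expn1; apply/eqP/mapP => [/(fixed_in_range iota)[y ->]|[y _ ->]].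
      by exists y; rewrite ?mem_enum.
    exact: range_fixed.
  rewrite big_map big_enum; apply: eq_bigr => x _; congr (chi _).
  apply: (fmorph_inj iota); rewrite iota_valprod_descent ?expn1 ?range_fixed //.
  by rewrite big_ord1 expn0 expr1 horner_map.
apply: (@newton_sequence_bound (Lcoef iota chi (h ^+ e)) _ _ q (2 * C + m)%:R
  ((d.-1 * m + d) * m.+1 + m + 2)%N); first exact: ltnW.
- exact: Lcoef0.
- move=> j Hj; apply: (Lcoef_eq0 chi0 chi1 chiM he0 H0 rooth u0 u1); move: Hj; lia.
- exact: Lcoef_newton.
- move=> k kk; rewrite -natrX; apply: Psum_even_bound.
  by apply: leq_trans kk (ltnW _); apply: ltn_expl.
Qed.

End Weil.

(** * Character sums along two square-free polynomials *)

Lemma two_multiplicities_nonpower (X : eqType) (rf rg : pred X) (a b d s : nat) :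
  gcdn (gcdn a b) d = 1%N -> (exists x, rf x) -> (exists x, rg x) ->
  (exists x, rf x != rg x) -> (0 < s < d)%N ->
  exists x, ~~ (d %| s * (a * rf x + b * rg x))%N.
Proof.
move=> g1; wlog: a b rf rg g1 / exists x, rf x && ~~ rg x.
  move=> W ef eg [x]; case fx: (rf x); case gx: (rg x) => // _ sd.
    by apply: (W a b rf rg) => //; exists x; rewrite ?fx ?gx.
  have [|||y] := W b a rg rf _ _ eg ef _ sd.
  - by rewrite (gcdnC b).
  - by exists x; rewrite gx fx.
  - by exists x; rewrite gx fx.
  by move=> H; exists y; rewrite addnC.
move=> [x /andP[fx gx]] _ [y gy] _ /andP[s0 sd].
(* If [d] divides [s * a], then at a root y of the second kind it would have to divide [s * b] too,
   hence s gcd(a, b, d) = s, which is less than d. *)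
case: (boolP (d %| s * a)%N) => [da|nda]; last first.
  by exists x; rewrite fx (negPf gx) muln1 muln0 addn0.
exists y; apply/negP; rewrite gy muln1 mulnDr dvdn_addr; last by rewrite mulnA dvdn_mulr.
move=> db; have : (d %| gcdn (gcdn (s * a) (s * b)) (s * d))%N.
  by rewrite !dvdn_gcd da db dvdn_mull.
rewrite -!muln_gcdr g1 muln1 => /(dvdn_leq s0); lia.
Qed.

Section TwoPolynomials.
Variables (F : finFieldType) (E : closedFieldType) (iota : {rmorphism F -> E}).
Variables f G : {poly F}.
Hypotheses (sf : (1 < size f)%N) (sG : (1 < size G)%N).
Hypotheses (sqf : sqfree_poly f) (sqG : sqfree_poly G).
Hypothesis nprop : ~ (exists c : F, f = c *: G).

Let f0 : f != 0. Proof. by rewrite -size_poly_gt0 ltnW. Qed.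
Let G0 : G != 0. Proof. by rewrite -size_poly_gt0 ltnW. Qed.
Let uf := sqfree_rts_uniq iota f0 sqf.
Let uG := sqfree_rts_uniq iota G0 sqG.

Lemma mup_map_rts (p : {poly F}) x : p != 0 -> mup x (map_poly iota p) = count_mem x (rts iota p).
Proof.
move=> p0; have l0 : iota (lead_coef p) != 0 by rewrite fmorph_eq0 lead_coef_eq0.
by rewrite rtsP -mul_polyC mupMr ?rootC // mu_prod_XsubC.
Qed.

Lemma exists_root (p : {poly F}) : (1 < size p)%N -> exists x, x \in rts iota p.
Proof.
move=> sp; have p0 : p != 0 by rewrite -size_poly_gt0 ltnW.
by case: (rts iota p) (size_rts iota p0) sp => [|x s _ _]; [case: (size p) => [|[]] | exists x; rewrite mem_head].
Qed.

Lemma rts_differ : exists x, (x \in rts iota f) != (x \in rts iota G).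
Proof.
case: (boolP (all (mem (rts iota G)) (rts iota f) && all (mem (rts iota f)) (rts iota G))); last first.
  rewrite negb_and => /orP[]/allPn[x xi /= nx]; exists x; by rewrite xi (negPf nx).
case/andP=> /allP fG /allP Gf; case: nprop.
have pfG : perm_eq (rts iota f) (rts iota G).
  apply: uniq_perm => // x; apply/idP/idP; [exact: fG | exact: Gf].
exists (lead_coef f / lead_coef G); apply: (map_poly_inj iota).
rewrite map_polyZ (rtsP iota f) (rtsP iota G) scalerA fmorph_div.
by rewrite divfK ?fmorph_eq0 ?lead_coef_eq0 // (perm_big _ pfG).
Qed.

(** The least common multiple of [f] and [G]; as both are square-free, it is the radical of
    [f * G]. *)
Definition rad2 : {poly F} := f %/ gcdp f G * G.

Lemma rad2_neq0 : rad2 != 0.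
Proof.
rewrite mulf_neq0 //; apply: contraNneq f0 => q0.
by rewrite -(divpK (dvdp_gcdl f G)) q0 mul0r.
Qed.

Lemma divp_gcdl_dvd : f %/ gcdp f G %| f.
Proof. by rewrite -[X in _ %| X](divpK (dvdp_gcdl f G)) dvdp_mulIl. Qed.

Lemma rad2_dvd : rad2 %| f * G.
Proof. by rewrite dvdp_mul // divp_gcdl_dvd. Qed.

Lemma root_rad2 x : root (map_poly iota rad2) x = root (map_poly iota (f * G)) x.
Proof.
apply/idP/idP.
  by rewrite -!dvdp_XsubCl => /dvdp_trans; apply; rewrite dvdp_map rad2_dvd.
rewrite /rad2 !rmorphM /= !rootM; case: (boolP (root (map_poly iota G) x)); rewrite ?orbT ?orbF // => nG.
rewrite -{1}(divpK (dvdp_gcdl f G)) rmorphM rootM /= => /orP[//|].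
move=> xg; case/negP: nG; move: xg; rewrite -!dvdp_XsubCl => /dvdp_trans; apply.
by rewrite dvdp_map dvdp_gcdr.
Qed.

Lemma rad2_separable : separable_poly rad2.
Proof.
have sep p : p != 0 -> uniq (rts iota p) -> separable_poly p.
  move=> p0 up; rewrite -(separable_map iota) rtsP.
  have l0 : iota (lead_coef p) != 0 by rewrite fmorph_eq0 lead_coef_eq0.
  by rewrite (eqp_separable (eqp_scale _ l0)) separable_prod_XsubC.
have sepf := sep f f0 uf; have sepG := sep G G0 uG.
have f1f := divp_gcdl_dvd.
rewrite separable_mul sepG (dvdp_separable f1f) //=.
have cop : coprimep (f %/ gcdp f G) (gcdp f G).
  by apply: (separable_coprime sepf); rewrite divpK ?dvdp_gcdl.
rewrite -gcdp_eqp1 -size_poly_eq1; apply/eqP.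
have : gcdp (f %/ gcdp f G) G %| gcdp (f %/ gcdp f G) (gcdp f G).
  by rewrite !dvdp_gcd dvdp_gcdl dvdp_gcdr (dvdp_trans (dvdp_gcdl _ _) f1f).
move/dvdp_leq; rewrite (eqP cop) -size_poly_gt0 (eqP cop) => /(_ isT) le1.
apply/eqP; rewrite eqn_leq le1 size_poly_gt0 gcdp_eq0 negb_and G0 orbT //.
Qed.

(** Links the splitting field of the hypothesis with the closure [E]: [rad2] is separable and
    divides [f * G], so over [L] it is a product of distinct linear factors, whose roots are among
    the D + 1 given ones. *)
Lemma size_rad2 D : nb_roots_in_splitting_field (f * G) D.+1 -> (size rad2 <= D.+2)%N.
Proof.
case=> L [[rs fGrs _] [s [us ss sP]]].
have dv : map_poly (in_alg L) rad2 %| \prod_(z <- rs) ('X - z%:P).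
  by rewrite -(eqp_dvdr _ fGrs) dvdp_map rad2_dvd.
have [mk eqm] := dvdp_prod_XsubC dv.
have um : uniq (mask mk rs).
  by rewrite -separable_prod_XsubC -(eqp_separable eqm) separable_map rad2_separable.
rewrite -(size_map_poly (in_alg L)) (eqp_size eqm) size_prod_XsubC ltnS -ss.
apply: uniq_leq_size => // x xm; rewrite sP (eqp_root fGrs) root_prod_XsubC.
exact: mem_mask xm.
Qed.

Lemma card_roots_le D : nb_roots_in_splitting_field (f * G) D.+1 ->
  (#|[set x : F | root (f * G) x]| <= D.+1)%N.
Proof.
move=> /size_rad2 sH; rewrite -ltnS; apply: leq_trans sH.
rewrite cardE; apply: max_poly_roots; rewrite ?rad2_neq0 ?enum_uniq //.
apply/allP => x; rewrite mem_enum inE => fx.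
by rewrite -(fmorph_root iota) root_rad2 fmorph_root.
Qed.

Variable chi : F -> algC.
Hypotheses (chi0 : chi 0 = 0) (chi1 : chi 1 = 1) (chiM : {morph chi : x y / x * y}).
Hypothesis chi_inj : injective chi.
Let q := #|F|.

(** With e = gcd(a, b, q - 1) the summand is chi(h^e) for h = f^(a/e) G^(b/e). Exponents run from 1
    to q - 1, the last being the trivial character; only when both are trivial does d = (q - 1) / e
    drop to 1. Otherwise no h^s, 0 < s < d, is a d-th power up to a constant, since [f] and [G] have
    different root sets. *)
Theorem weil_bound2 D a b : nb_roots_in_splitting_field (f * G) D.+1 ->
  (0 < a <= q.-1)%N -> (0 < b <= q.-1)%N -> ~~ ((a == q.-1) && (b == q.-1)) ->
  `|\sum_(x : F) chi f.[x] ^+ a * chi G.[x] ^+ b| <= D%:R * sqrtC q%:R.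
Proof.
move=> nbr /andP[a0 aq] /andP[b0 bq] nab.
pose e := gcdn (gcdn a b) q.-1; pose d := (q.-1 %/ e)%N.
have e0 : (0 < e)%N by rewrite !gcdn_gt0 a0.
have eq : (e %| q.-1)%N by apply: dvdn_gcdr.
have ea : (e %| a)%N by rewrite /e -gcdnA dvdn_gcdl.
have eb : (e %| b)%N by rewrite /e (gcdnC a) -gcdnA dvdn_gcdl.
have de : (d * e = q.-1)%N by rewrite divnK.
have d1 : (1 < d)%N.
  rewrite ltnNge; apply: contra nab => d1.
  have eqq : (q.-1 <= e)%N by rewrite -de -[X in (_ <= X)%N]mul1n leq_mul2r d1 orbT.
  by rewrite !eqn_leq aq bq (leq_trans eqq (dvdn_leq a0 ea)) (leq_trans eqq (dvdn_leq b0 eb)).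
pose h := f ^+ (a %/ e) * G ^+ (b %/ e).
have h0 : h != 0 by rewrite mulf_neq0 ?expf_neq0.
have a'0 : (0 < a %/ e)%N by rewrite divn_gt0 // dvdn_leq.
have b'0 : (0 < b %/ e)%N by rewrite divn_gt0 // dvdn_leq.
have np s : (0 < s < d)%N -> exists x, ~~ (d %| s * mup x (map_poly iota h))%N.
  move=> sd.
  have [||||x xP] := @two_multiplicities_nonpower _ (mem (rts iota f)) (mem (rts iota G)) (a %/ e) (b %/ e) d s _ _ _ _ sd.
  - by apply/eqP; rewrite -(eqn_pmul2r e0) mul1n !muln_gcdl !divnK.
  - exact: exists_root.
  - exact: exists_root.
  - exact: rts_differ.
  exists x; rewrite /h rmorphM !rmorphXn /= mupM ?expf_neq0 ?map_poly_eq0 //.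
  rewrite !mup_exp ?map_poly_eq0 // !mup_map_rts //.
  by rewrite !count_uniq_mem.
have hH x : root (map_poly iota h) x = root (map_poly iota rad2) x.
  rewrite root_rad2 /h !rmorphM !rmorphXn /= !rootM !rootE !horner_exp !expf_eq0 a'0 b'0 //.
have := weil_bound chi0 chi1 chiM chi_inj h0 d1 de np rad2_neq0 hH.
rewrite (eq_bigr (fun x => chi f.[x] ^+ a * chi G.[x] ^+ b)); last first.
  move=> x _; rewrite horner_exp (chiX chi1 chiM) /h hornerM !horner_exp chiM !(chiX chi1 chiM).
  by rewrite exprMn -!exprM !divnK.
move/le_trans; apply; rewrite ler_wpM2r ?sqrtC_ge0 ?ler0n // ler_nat.
have := size_rad2 nbr; lia.
Qed.

End TwoPolynomials.

(** * Characters and free elements *)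

Lemma primitive_root_neq0 (R : fieldType) n (z : R) : n.-primitive_root z -> z != 0.
Proof.
move=> zP; apply/eqP => z0; have := prim_expr_order zP.
rewrite z0 expr0n gtn_eqF ?(prim_order_gt0 zP) //.
by move/eqP; rewrite eq_sym oner_eq0.
Qed.

Section Characters.
Variable F : finFieldType.
Let Q := #|F|.-1.

Lemma Qord_gt0 : (0 < Q)%N.
Proof. by have := finNzRing_gt1 F; rewrite /Q; case: #|_| => [|[]]. Qed.

Lemma expf_Qord (x : F) : x != 0 -> x ^+ Q = 1.
Proof.
move=> x0; apply: (mulfI x0); rewrite -exprS prednK ?expf_card ?mulr1 //.
exact: ltnW (finNzRing_gt1 F).
Qed.

Lemma exists_generator : exists g : F, Q.-primitive_root g.
Proof.
have /hasP[g _ gP] : has (Q.-primitive_root) (enum (predC1 (0 : F))).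
  apply: has_prim_root; rewrite ?enum_uniq ?Qord_gt0 -?cardE ?cardC1 //.
  by apply/allP => x; rewrite mem_enum => x0; rewrite unity_rootE expf_Qord.
by exists g.
Qed.

(** A generator is sent to a primitive complex root of unity of the same order. By injectivity the
    powers of [chi] exhaust the characters. *)
Lemma exists_chi : exists chi : F -> algC,
  [/\ chi 0 = 0, chi 1 = 1, {morph chi : x y / x * y} & injective chi].
Proof.
have [g gP] := exists_generator; have [w wP] := C_prim_root_exists Qord_gt0.
have g0 : g != 0 by exact: primitive_root_neq0 gP.
have logP x : x != 0 -> exists i : 'I_Q, x = g ^+ i.
  by move=> /expf_Qord /(prim_rootP gP)[i ->]; exists i.
pose chi x : algC := if [pick i : 'I_Q | g ^+ i == x] is Some i then w ^+ i else 0.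
have chiE n : chi (g ^+ n) = w ^+ n.
  rewrite /chi; case: pickP => [i|].
    by rewrite (eq_prim_root_expr gP) => H; apply/eqP; rewrite (eq_prim_root_expr wP).
  by have [i ->] := logP _ (expf_neq0 n g0) => /(_ i); rewrite eqxx.
have c0 : chi 0 = 0.
  by rewrite /chi; case: pickP => // i; rewrite expf_eq0 (negPf g0) andbF.
have w0 : w != 0 by exact: primitive_root_neq0 wP.
exists chi; split=> //; first by have := chiE 0%N; rewrite !expr0.
  move=> x y; have [->|x0] := eqVneq x 0; first by rewrite mul0r c0 mul0r.
  have [->|y0] := eqVneq y 0; first by rewrite mulr0 c0 mulr0.
  have [[i ->] [j ->]] := (logP x x0, logP y y0).
  by rewrite -exprD !chiE exprD.
move=> x y; have [->|x0] := eqVneq x 0; have [->|y0] := eqVneq y 0 => //.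
- have [j ->] := logP y y0; rewrite c0 chiE => /esym/eqP.
  by rewrite expf_eq0 (negPf w0) andbF.
- have [j ->] := logP x x0; rewrite c0 chiE => /eqP.
  by rewrite expf_eq0 (negPf w0) andbF.
have [[i ->] [j ->]] := (logP x x0, logP y y0).
rewrite !chiE => /eqP; rewrite (eq_prim_root_expr wP) => H; apply/eqP.
by rewrite (eq_prim_root_expr gP).
Qed.

Lemma expr_gcd1 (x : F) a b : x ^+ a = 1 -> x ^+ b = 1 -> x ^+ gcdn a b = 1.
Proof.
move=> xa xb; have [->|a0] := posnP a; first by rewrite gcd0n.
case: (egcdnP b a0) => km kn E1 _; have := congr1 (fun n => x ^+ n) E1.
by rewrite exprD !(mulnC _ a) !(mulnC _ b) !exprM xa xb !expr1n mul1r.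
Qed.

(** It is enough to test prime s: an element of the subgroup of order Q/n is a p-th power in it
    exactly when its power of exponent Q/(np) is 1. For a general s, the prime tested is
    [pdiv s]. *)
Lemma rn_freeP (r n : nat) (x : F) : (0 < n)%N -> (n %| Q)%N -> (r %| Q %/ n)%N ->
  rn_free r n x = [&& x != 0, x ^+ (Q %/ n) == 1 &
    all (fun p => x ^+ (Q %/ (n * p)) != 1) (primes r)].
Proof.
move=> n0 nQ rQ.
have Qn0 : (0 < Q %/ n)%N by rewrite divn_gt0 // dvdn_leq // Qord_gt0.
have r0 : (0 < r)%N by apply: dvdn_gt0 rQ.
rewrite /rn_free /Qord -/Q; case: insubP => [u|]; last first.
  by rewrite unitfE negbK => /eqP ->; rewrite eqxx.
rewrite unitfE => x0 xE; rewrite x0 /=.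
have uE k : (u ^+ k == 1)%g = (x ^+ k == 1) by rewrite -val_eqE /= FinRing.val_unitX xE.
rewrite order_dvdn uE; case: eqP => //= xQn.
apply/forall_inP/allP => [H p|H g].
  rewrite mem_primes => /and3P[pp _ pr]; apply/negP => /eqP xp.
  have pQ : (p %| Q %/ n)%N by apply: dvdn_trans rQ.
  have npQ : (n * p %| Q)%N by rewrite -(divnK nQ) mulnC dvdn_mul.
  have [g gP] := exists_generator.
  have [i xi] := prim_rootP gP (expf_Qord x0).
  have wpos : (0 < Q %/ (n * p))%N by rewrite divn_gt0 ?muln_gt0 ?n0 ?prime_gt0 // dvdn_leq // Qord_gt0.
  (* The discrete logarithm i of x is a multiple of n p, so g^(i/p) is a p-th root of x inside the
     subgroup of order Q/n. *)
  have npi : (n * p %| i)%N.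
    move: xp; rewrite xi -exprM => /eqP; rewrite -(prim_order_dvd gP).
    by rewrite -{1}(divnK npQ) mulnC dvdn_pmul2r.
  have g0 : g != 0 by exact: primitive_root_neq0 gP.
  have ug : g ^+ (i %/ p) \is a GRing.unit by rewrite unitfE expf_neq0.
  pose v : {unit F} := FinRing.unit F ug.
  have := H v; rewrite inE -val_eqE /= FinRing.val_unitX /= -exprM.
  have -> : (g ^+ (i %/ p * (Q %/ n)) == 1).
    rewrite -(prim_order_dvd gP) -{1}(divnK nQ) mulnC dvdn_mul // dvdn_divRL.
      by [].
    by apply: dvdn_trans npi; apply: dvdn_mull.
  move=> /(_ isT) /forallP.
  have pr' : (p < r.+1)%N by rewrite ltnS dvdn_leq.
  move/(_ (Ordinal pr')) => /=; rewrite pr /=.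
  have -> : (u == v ^+ p)%g.
    rewrite -val_eqE /= FinRing.val_unitX xE /= -exprM divnK -?xi //.
    by apply: dvdn_trans npi; apply: dvdn_mull.
  by rewrite implyTb => /eqP p1; rewrite p1 in pp.
rewrite inE => gQ; apply/forallP => s; apply/implyP => sr; apply/implyP => /eqP us.
apply/eqP; apply: contraTeq isT => s1.
have s0 : (0 < s)%N by apply: dvdn_gt0 sr.
have s2 : (1 < s)%N by case: (val s) s0 s1 => [|[]].
have pp := pdiv_prime s2; have ps := pdiv_dvd s.
have := H (pdiv s); rewrite mem_primes pp r0 (dvdn_trans ps sr) => /(_ isT).
have psQ : (pdiv s %| Q %/ n)%N by apply: dvdn_trans rQ; apply: dvdn_trans sr.
have e1 : (s * (Q %/ (n * pdiv s)) = (Q %/ n) * (s %/ pdiv s))%N.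
  by rewrite -{1}(divnK ps) -mulnA divnMA (mulnC (pdiv s)) divnK // mulnC.
by rewrite -uE us -expgM e1 expgM (eqP gQ) expg1n eqxx.
Qed.

End Characters.

(** * Fourier expansions *)

Lemma sum_const_ord (R : pzSemiRingType) n (x : R) : \sum_(i < n) x = n%:R * x.
Proof. by rewrite sumr_const card_ord mulr_natl. Qed.

Section Wiener.
Variable F : finFieldType.
Let Q := #|F|.-1.
Variable chi : F -> algC.
Hypotheses (chi0 : chi 0 = 0) (chi1 : chi 1 = 1) (chiM : {morph chi : x y / x * y}).
Hypothesis chi_inj : injective chi.

Let chiX := chiX chi1 chiM.

Let Q0 : (0 < Q)%N. Proof. exact: Qord_gt0. Qed.

Lemma chi_expr1 x k : (chi x ^+ k == 1) = (x ^+ k == 1).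
Proof. by rewrite -chiX -[in LHS]chi1 (inj_eq chi_inj). Qed.

Lemma sum_chi k : (0 < k)%N -> \sum_x chi x ^+ k = if (Q %| k)%N then Q%:R else 0.
Proof.
move=> k0; case: (boolP (Q %| k)%N) => [/dvdnP[j kE]|nk].
  rewrite (bigD1 0) //= chi0 expr0n (gtn_eqF k0) add0r.
  rewrite (eq_bigr (fun=> 1)); last first.
    by move=> x x0; rewrite -chiX kE mulnC exprM expf_Qord // expr1n chi1.
  by rewrite sumr_const cardC1.
have [g gP] := exists_generator F.
have gk : chi g ^+ k != 1 by rewrite chi_expr1 -(prim_order_dvd gP).
have g0 := primitive_root_neq0 gP.
set s := \sum_x _; have E : s = chi g ^+ k * s.
  rewrite {1}/s (reindex_inj (mulfI g0)) mulr_sumr.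
  by apply: eq_bigr => x _; rewrite chiM exprMn.
apply/eqP; move/eqP: E; rewrite -subr_eq0 -{1}[s]mul1r -mulrBl mulf_eq0 subr_eq0.
by rewrite eq_sym (negPf gk).
Qed.

Definition powind (d : nat) (x : F) : algC := ((x != 0) && (x ^+ (Q %/ d) == 1))%:R.
Local Notation u := powind.

Lemma powind_fourier d x : (0 < d)%N -> (d %| Q)%N ->
  u d x = d%:R^-1 * \sum_(j < d) chi x ^+ (j.+1 * (Q %/ d)).
Proof.
move=> d0 dQ; have w0 : (0 < Q %/ d)%N by rewrite divn_gt0 // dvdn_leq.
have dn0 : d%:R != 0 :> algC by rewrite pnatr_eq0 -lt0n.
rewrite /u; have [->|x0] := eqVneq x 0.
  by rewrite big1 ?mulr0 // => j _; rewrite chi0 expr0n muln_eq0 (gtn_eqF w0).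
rewrite /= -chi_expr1; set y := chi x ^+ _.
have yd : y ^+ d = 1 by rewrite /y -exprM divnK // -chiX expf_Qord.
have -> : \sum_(j < d) chi x ^+ (j.+1 * (Q %/ d)) = y * \sum_(j < d) y ^+ j.
  by rewrite mulr_sumr; apply: eq_bigr => j _; rewrite -exprS /y -exprM mulnC.
have [y1|y1] := eqVneq y 1.
  rewrite y1 mul1r (eq_bigr (fun=> 1)) => [|j _]; last by rewrite expr1n.
  by rewrite sumr_const card_ord mulVf.
have := subrX1 y d; rewrite yd subrr => /esym/eqP; rewrite mulf_eq0 subr_eq0 (negPf y1) /=.
by move/eqP->; rewrite !mulr0.
Qed.

Lemma sum_powind d : (0 < d)%N -> (d %| Q)%N -> \sum_x u d x = (Q %/ d)%:R.
Proof.
move=> d0 dQ; have w0 : (0 < Q %/ d)%N by rewrite divn_gt0 // dvdn_leq.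
have dn0 : d%:R != 0 :> algC by rewrite pnatr_eq0 -lt0n.
under eq_bigr do rewrite powind_fourier //.
rewrite -mulr_sumr exchange_big /=.
rewrite (eq_bigr (fun j : 'I_d => if (d %| j.+1)%N then Q%:R else 0)); last first.
  move=> j _; rewrite sum_chi ?muln_gt0 //.
  by rewrite -{1}(divnK dQ) mulnC dvdn_pmul2r.
rewrite -big_mkcond; have dlt : (d.-1 < d)%N by rewrite prednK.
rewrite (big_pred1 (Ordinal dlt)) => [|j].
  by apply: (mulfI dn0); rewrite mulrA mulfV // mul1r -natrM mulnC divnK.
rewrite /= -val_eqE /=; apply/idP/eqP => [/dvdn_leq H|->]; last by rewrite prednK.
have := ltn_ord j; have := H isT; lia.
Qed.

Lemma powindM n c p x : (0 < n)%N -> (0 < c)%N -> (0 < p)%N -> coprime p c ->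
  (n * c * p %| Q)%N -> u (n * c) x * u (n * p) x = u (n * c * p) x.
Proof.
move=> n0 c0 p0 pc /dvdnP[w Qw]; rewrite /u -natrM mulnb.
have -> : (Q %/ (n * c) = w * p)%N.
  by rewrite Qw (mulnC _ p) mulnA mulnK // muln_gt0 n0.
have -> : (Q %/ (n * p) = w * c)%N.
  by rewrite Qw mulnAC (mulnC _ c) mulnA mulnK // muln_gt0 n0.
have -> : (Q %/ (n * c * p) = w)%N by rewrite Qw mulnK // !muln_gt0 n0 c0.
case: (x != 0) => //=; congr (nat_of_bool _)%:R.
apply/andP/eqP => [[/eqP xp /eqP xc]|xw]; last by rewrite !exprM xw !expr1n.
by have := expr_gcd1 xp xc; rewrite -muln_gcdr (eqP pc) muln1.
Qed.

Lemma powindMl n p x : (0 < n)%N -> (0 < p)%N -> (n * p %| Q)%N -> u n x * u (n * p) x = u (n * p) x.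
Proof.
move=> n0 p0 npQ; have := @powindM n 1 p x; rewrite muln1; apply=> //.
by rewrite coprimen1.
Qed.

Lemma powind_idem n x : u n x * u n x = u n x.
Proof. by rewrite /u -natrM mulnb andbb. Qed.

Definition indic n T x : algC := u n x * \prod_(p <- T) (1 - u (n * p) x).

(** The extra modulus [c] carries the induction: expanding the factor of p turns u_(nc) into u_(nc)
    - u_(ncp). *)
Lemma sum_powind_sieve n c T : (0 < n)%N -> (0 < c)%N -> uniq T -> all prime T ->
  all (coprime^~ c) T -> (n * c * \prod_(p <- T) p %| Q)%N ->
  \sum_x u (n * c) x * \prod_(p <- T) (1 - u (n * p) x) =
  Q%:R / (n * c)%:R * \prod_(p <- T) (1 - p%:R^-1).
Proof.
move=> n0; elim: T c => [|p T IH] c c0 /=.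
  rewrite !big_nil muln1 => _ _ _ ncQ; under eq_bigr do rewrite big_nil mulr1.
  rewrite sum_powind ?muln_gt0 ?n0 // mulr1; apply: (canRL (mulfK _)).
    by rewrite pnatr_eq0 muln_eq0 negb_or -!lt0n n0.
  by rewrite -natrM divnK.
move=> /andP[pT uT] /andP[pp aT] /andP[pc cT]; rewrite !big_cons => dvQ.
have p0 := prime_gt0 pp.
have dvp : (n * c * p %| Q)%N by apply: dvdn_trans dvQ; rewrite mulnA dvdn_mulr.
have dvT : (n * c * \prod_(j <- T) j %| Q)%N.
  by apply: dvdn_trans dvQ; rewrite dvdn_mul // dvdn_mull.
rewrite (eq_bigr (fun x => u (n * c) x * \prod_(j <- T) (1 - u (n * j) x)
   - u (n * (c * p)) x * \prod_(j <- T) (1 - u (n * j) x))); last first.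
  by move=> x _; rewrite big_cons mulrA -mulrBl mulrBr mulr1 powindM // mulnA.
rewrite sumrB !IH ?muln_gt0 ?c0 //.
- have n1 : n%:R != 0 :> algC by rewrite pnatr_eq0 -lt0n.
  have c1 : c%:R != 0 :> algC by rewrite pnatr_eq0 -lt0n.
  have p1 : p%:R != 0 :> algC by rewrite pnatr_eq0 -lt0n.
  by rewrite !natrM; field; rewrite ?n1 ?c1 ?p1.
- apply/allP => j jT; rewrite coprimeMr (allP cT) //= prime_coprime ?(allP aT j jT) //.
  by rewrite (dvdn_prime2 (allP aT j jT) pp); apply: contraNneq pT => <-.
- by rewrite -!mulnA in dvQ *.
Qed.

Lemma sum_indic n T : (0 < n)%N -> uniq T -> all prime T ->
  (n * \prod_(p <- T) p %| Q)%N ->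
  \sum_x indic n T x = Q%:R / n%:R * \prod_(p <- T) (1 - p%:R^-1).
Proof.
move=> n0 uT aT dvQ; have := @sum_powind_sieve n 1 T; rewrite muln1; apply=> //.
by apply/allP => p _; rewrite coprimen1.
Qed.

(* [A] bounds the l1-norm of the Fourier coefficients of [I]; the exponents are kept
   positive so that every character, trivial or not, vanishes at [0]. *)
Definition wiener (I : F -> algC) (A : algC) : Prop :=
  exists (T : finType) (a : T -> algC) (k : T -> nat),
    [/\ forall t, (0 < k t)%N, forall x, I x = \sum_t a t * chi x ^+ k t
      & \sum_t `|a t| <= A].

Lemma wiener_ext I J A : I =1 J -> wiener I A -> wiener J A.
Proof.
by move=> IJ [T [a [k [k0 Ia aA]]]]; exists T, a, k; split=> // x; rewrite -IJ.
Qed.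

Lemma wiener_mul I J A B : wiener I A -> wiener J B -> wiener (fun x => I x * J x) (A * B).
Proof.
move=> [T [a [k [k0 Ia aA]]]] [S [b [l [l0 Jb bB]]]].
exists (T * S)%type, (fun p => a p.1 * b p.2), (fun p => (k p.1 + l p.2)%N).
split=> [t|x|]; first by rewrite addn_gt0 k0.
  rewrite Ia Jb mulr_suml -(pair_bigA _ (fun t s => a t * b s * chi x ^+ (k t + l s))) /=.
  apply: eq_bigr => t _; rewrite mulr_sumr; apply: eq_bigr => s _.
  by rewrite exprD mulrACA.
rewrite -(pair_bigA _ (fun t s => `|a t * b s|)) /=.
under eq_bigr do under eq_bigr do rewrite normrM.
under eq_bigr do rewrite -mulr_sumr.
by rewrite -mulr_suml ler_pM // sumr_ge0.
Qed.

Lemma wiener_powind n : (0 < n)%N -> (n %| Q)%N -> wiener (u n) 1.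
Proof.
move=> n0 nQ; have w0 : (0 < Q %/ n)%N by rewrite divn_gt0 // dvdn_leq.
exists 'I_n, (fun=> n%:R^-1), (fun j : 'I_n => (j.+1 * (Q %/ n))%N); split.
- by move=> j; rewrite muln_gt0.
- by move=> x; rewrite powind_fourier // mulr_sumr.
- rewrite sum_const_ord ger0_norm ?invr_ge0 ?ler0n // mulfV //.
  by rewrite pnatr_eq0 -lt0n.
Qed.

Lemma sum_multiples (R : nmodType) n p (f : nat -> R) : (0 < p)%N ->
  \sum_(j < n * p) (if (p %| j.+1)%N then f j.+1 else 0) = \sum_(i < n) f (i.+1 * p)%N.
Proof.
move=> p0; elim: n => [|n IH]; first by rewrite mul0n !big_ord0.
rewrite big_ord_recr /= -IH -[in LHS](big_mkord xpredT (fun j => if (p %| j.+1)%N then f j.+1 else 0)).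
rewrite (big_cat_nat _ (n := (n * p)%N)) //=; last by rewrite leq_mul2r leqnSn orbT.
rewrite big_mkord; congr (_ + _).
rewrite -{1}[(n * p)%N]add0n big_addn mulSn addnK big_mkord.
have plt : (p.-1 < p)%N by rewrite prednK.
rewrite (bigD1 (Ordinal plt)) //= big1 ?addr0.
  by rewrite -addSn prednK // dvdn_addr // dvdn_mull.
move=> i; rewrite -val_eqE /= => ip; case: ifP => //.
rewrite -addSn dvdn_addl ?dvdn_mull // => /dvdn_leq => /(_ isT) H.
by have := ltn_ord i; lia.
Qed.

(** Of the n p characters involved, n have coefficient c/n - 1/(np) and the other n p - n have
    -1/(np). The case c = 1 gives the norm 2 (1 - 1/p); the case c = 1/p removes the first kind,
    including the trivial character, and leaves 1 - 1/p. *)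
Lemma wiener_combination n p (c : algC) : (0 < n)%N -> (0 < p)%N -> (n * p %| Q)%N ->
  wiener (fun x => c * u n x - u (n * p) x) (`|c - p%:R^-1| + (1 - p%:R^-1)).
Proof.
move=> n0 p0 npQ; have np0 : (0 < n * p)%N by rewrite muln_gt0 n0.
have nQ : (n %| Q)%N by apply: dvdn_trans npQ; apply: dvdn_mulr.
have w0 : (0 < Q %/ (n * p))%N by rewrite divn_gt0 // dvdn_leq.
have n1 : n%:R != 0 :> algC by rewrite pnatr_eq0 -lt0n.
have p1 : p%:R != 0 :> algC by rewrite pnatr_eq0 -lt0n.
exists 'I_(n * p), (fun j : 'I_(n * p) => (if (p %| j.+1)%N then c / n%:R else 0) - (n * p)%:R^-1),
  (fun j : 'I_(n * p) => (j.+1 * (Q %/ (n * p)))%N); split.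
- by move=> j; rewrite muln_gt0.
- move=> x; rewrite !powind_fourier //.
  under [RHS]eq_bigr do rewrite mulrBl.
  rewrite sumrB -mulr_sumr; congr (_ - _).
  rewrite (eq_bigr (fun j : 'I_(n * p) => if (p %| j.+1)%N then (fun i => c / n%:R * chi x ^+ (i * (Q %/ (n * p)))) j.+1 else 0)); last first.
    by move=> j _ /=; case: ifP => _ //; rewrite mul0r.
  rewrite (sum_multiples _ (fun i => c / n%:R * chi x ^+ (i * (Q %/ (n * p))))) //.
  rewrite mulrA mulr_sumr; apply: eq_bigr => i _; congr (_ * _ ^+ _).
  rewrite -mulnA; congr (_ * _)%N; case/dvdnP: npQ => w ->.
  by rewrite mulnK // mulnCA mulKn // mulnC.
rewrite le_eqVlt; apply/orP; left; apply/eqP.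
have e1 : n%:R * `|c / n%:R - (n * p)%:R^-1| = `|c - p%:R^-1|.
  rewrite -{1}[n%:R]normr_nat -normrM; congr `|_|.
  by rewrite natrM; field; rewrite ?p1 ?n1.
rewrite (eq_bigr (fun j : 'I_(n * p) => (if (p %| j.+1)%N then
    (fun=> `|c / n%:R - (n * p)%:R^-1| - (n * p)%:R^-1) j.+1 else 0) + (n * p)%:R^-1)); last first.
  move=> j _; case: ifP => _; first by rewrite subrK.
  by rewrite sub0r add0r normrN ger0_norm // invr_ge0 ler0n.
rewrite big_split /= (sum_multiples _ (fun=> _)) // !sum_const_ord.
rewrite mulrBr e1 -addrA; congr (_ + _).
by rewrite natrM; field; rewrite ?p1 ?n1.
Qed.

Lemma indic_cons n p T x : (0 < n)%N -> (0 < p)%N -> (n * p %| Q)%N ->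
  indic n (p :: T) x = indic n T x * (1 * u n x - u (n * p) x).
Proof.
move=> n0 p0 npQ; rewrite /indic big_cons mul1r mulrAC mulrBr powind_idem powindMl //.
by rewrite mulrA mulrBr mulr1 powindMl.
Qed.

Lemma indic_cons_sub n p T x : (0 < n)%N -> (0 < p)%N -> (n * p %| Q)%N ->
  indic n (p :: T) x - (1 - p%:R^-1) * indic n T x =
  indic n T x * (p%:R^-1 * u n x - u (n * p) x).
Proof.
move=> n0 p0 npQ; rewrite indic_cons // mul1r.
have E1 : indic n T x * u n x = indic n T x by rewrite /indic mulrAC powind_idem.
by rewrite mulrBr E1 [in RHS]mulrBr [in RHS]mulrCA E1; ring.
Qed.

Lemma invn_le1 p : (0 < p)%N -> 0 <= 1 - p%:R^-1 :> algC.
Proof. by move=> p0; rewrite subr_ge0 invf_le1 ?ltr0n // ler1n. Qed.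

Lemma wiener_indic n T : (0 < n)%N -> (n %| Q)%N ->
  (forall p, p \in T -> (0 < p)%N && (n * p %| Q)%N) ->
  wiener (indic n T) (\prod_(p <- T) (2%:R * (1 - p%:R^-1))).
Proof.
move=> n0 nQ; elim: T => [|p T IH] TP.
  rewrite big_nil; apply: wiener_ext (wiener_powind n0 nQ) => x.
  by rewrite /indic big_nil mulr1.
have /andP[p0 npQ] := TP p (mem_head _ _).
have wT := IH (fun j jT => TP j (mem_behead (s := p :: T) jT)).
rewrite big_cons mulrC.
have := wiener_mul wT (wiener_combination 1 n0 p0 npQ).
rewrite ger0_norm ?invn_le1 // -mulr2n.
have -> : (1 - p%:R^-1) *+ 2 = 2%:R * (1 - p%:R^-1) :> algC by rewrite mulr_natl.
by apply: wiener_ext => x; rewrite indic_cons.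
Qed.

Lemma wiener_indic_sub n p T : (0 < n)%N -> (n %| Q)%N -> (0 < p)%N -> (n * p %| Q)%N ->
  (forall p, p \in T -> (0 < p)%N && (n * p %| Q)%N) ->
  wiener (fun x => indic n (p :: T) x - (1 - p%:R^-1) * indic n T x)
    (\prod_(p <- T) (2%:R * (1 - p%:R^-1)) * (1 - p%:R^-1)).
Proof.
move=> n0 nQ p0 npQ TP.
have := wiener_mul (wiener_indic n0 nQ TP) (wiener_combination p%:R^-1 n0 p0 npQ).
rewrite subrr normr0 add0r; apply: wiener_ext => x.
by rewrite indic_cons_sub.
Qed.

(** Exponents are reduced to the range from 1 to Q, not from 0 to Q - 1, so that the value at 0
    remains 0. *)
Lemma chi_expr_red y k : (0 < k)%N -> chi y ^+ k = chi y ^+ (k.-1 %% Q).+1.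
Proof.
move=> k0; have [->|y0] := eqVneq y 0; first by rewrite chi0 !expr0n (gtn_eqF k0).
rewrite -{1}(prednK k0) {1}(divn_eq k.-1 Q) exprS exprD mulnC exprM -chiX.
by rewrite (expf_Qord y0) chi1 expr1n mul1r exprS.
Qed.

Lemma red_eq k : (0 < k)%N -> ((k.-1 %% Q).+1 == Q) = (Q %| k)%N.
Proof.
move=> k0; rewrite -{2}(prednK k0) {2}(divn_eq k.-1 Q) -addnS dvdn_addr ?dvdn_mull //.
apply/eqP/idP => [->//|]; move/dvdn_leq => /(_ isT) H.
by apply/eqP; rewrite eqn_leq H ltn_mod Q0.
Qed.

Lemma wiener_mean (T : finType) (a : T -> algC) (k : T -> nat) I :
  (forall t, (0 < k t)%N) -> (forall x, I x = \sum_t a t * chi x ^+ k t) ->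
  (\sum_x I x) / Q%:R = \sum_(t | (Q %| k t)%N) a t.
Proof.
move=> k0 IE; under eq_bigr do rewrite IE.
rewrite exchange_big mulr_suml [RHS]big_mkcond /=; apply: eq_bigr => t _ /=.
rewrite -mulr_sumr sum_chi //; case: ifP => _; last by rewrite mulr0 mul0r.
by rewrite mulfK // pnatr_eq0 -lt0n.
Qed.

(** * Correlation of two Fourier expansions along f and G *)

Section Correlation.
Variables (E : closedFieldType) (iota : {rmorphism F -> E}).
Variables (f G : {poly F}) (D : nat).
Hypotheses (sf : (1 < size f)%N) (sG : (1 < size G)%N).
Hypotheses (sqf : sqfree_poly f) (sqG : sqfree_poly G).
Hypothesis nprop : ~ (exists c : F, f = c *: G).
Hypothesis nbr : nb_roots_in_splitting_field (f * G) D.+1.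

Definition nonzeros : nat := #|[set x : F | ~~ root (f * G) x]|.

(** Pairs of trivial characters give the main term exactly, and every other pair is at most D sqrt q
    by Weil's bound. The trivial pairs carry l1-mass at least |mI mJ|, which is taken off the error;
    this saving later pays for the zeros of [f * G]. *)
Lemma wiener_correlation I J A B : wiener I A -> wiener J B ->
  let mI := (\sum_x I x) / Q%:R in let mJ := (\sum_x J x) / Q%:R in
  `|\sum_x I f.[x] * J G.[x] - mI * mJ * nonzeros%:R| <=
    (A * B - `|mI * mJ|) * (D%:R * sqrtC #|F|%:R).
Proof.
move=> [T [a [k [k0 Ia aA]]]] [S [b [l [l0 Jb bB]]]] /=.
rewrite (wiener_mean k0 Ia) (wiener_mean l0 Jb).
pose s (p : T * S) := \sum_x chi f.[x] ^+ k p.1 * chi G.[x] ^+ l p.2.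
pose P (p : T * S) := (Q %| k p.1)%N && (Q %| l p.2)%N.
have sE : \sum_x I f.[x] * J G.[x] = \sum_p a p.1 * b p.2 * s p.
  under [RHS]eq_bigr do rewrite /s mulr_sumr.
  rewrite [RHS]exchange_big; apply: eq_bigr => x _; rewrite Ia Jb mulr_suml.
  rewrite -(pair_bigA _ (fun t j => a t * b j * (chi f.[x] ^+ k t * chi G.[x] ^+ l j))) /=.
  apply: eq_bigr => t _; rewrite mulr_sumr; apply: eq_bigr => j _.
  by rewrite mulrACA.
have sP p : P p -> s p = nonzeros%:R.
  case/andP=> /dvdnP[i ki] /dvdnP[j lj].
  rewrite /s /nonzeros -sum1_card natr_sum [RHS]big_mkcond /=.
  apply: eq_bigr => x _; rewrite inE rootM !rootE.
  have kk0 := k0 p.1; have ll0 := l0 p.2.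
  have [->|fx] := eqVneq f.[x] 0; first by rewrite chi0 expr0n (gtn_eqF kk0) mul0r.
  have [->|gx] := eqVneq G.[x] 0; first by rewrite chi0 !expr0n (gtn_eqF ll0) mulr0.
  rewrite ki lj mulnC exprM -chiX expf_Qord // chi1 expr1n mul1r.
  by rewrite mulnC exprM -chiX expf_Qord // chi1 expr1n.
have sN p : ~~ P p -> `|s p| <= D%:R * sqrtC #|F|%:R.
  move=> nP; rewrite /s.
  under eq_bigr do rewrite (chi_expr_red _ (k0 p.1)) (chi_expr_red _ (l0 p.2)).
  apply: (weil_bound2 iota sf sG sqf sqG nprop chi0 chi1 chiM chi_inj nbr); rewrite /= ?ltn_mod //.
  by rewrite !red_eq.
rewrite sE (bigID P) /= (eq_bigr (fun p => a p.1 * b p.2 * nonzeros%:R)); last first.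
  by move=> p Pp; rewrite sP.
have PE (R : pzRingType) (v : T -> R) (w : S -> R) :
    (\sum_(t | (Q %| k t)%N) v t) * (\sum_(t | (Q %| l t)%N) w t) = \sum_(p | P p) v p.1 * w p.2.
  rewrite mulr_suml -(pair_big (fun t => Q %| k t)%N (fun t => Q %| l t)%N (fun t j => v t * w j)) /=.
  by apply: eq_bigr => t _; rewrite mulr_sumr.
rewrite -mulr_suml -PE addrAC subrr add0r.
apply: (le_trans (ler_norm_sum _ _ _)).
apply: (@le_trans _ _ (\sum_(p | ~~ P p) `|a p.1| * `|b p.2| * (D%:R * sqrtC #|F|%:R))).
  by apply: ler_sum => p nP; rewrite !normrM ler_wpM2l ?mulr_ge0 // sN.
rewrite -mulr_suml ler_wpM2r ?mulr_ge0 ?ler0n ?sqrtC_ge0 ?ler0n //.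
have all : (\sum_t `|a t|) * (\sum_t `|b t|) = \sum_p `|a p.1| * `|b p.2|.
  rewrite mulr_suml -(pair_bigA _ (fun t j => `|a t| * `|b j|)) /=.
  by apply: eq_bigr => t _; rewrite mulr_sumr.
rewrite lerBrDr.
apply: (@le_trans _ _ (\sum_p `|a p.1| * `|b p.2|)); last first.
  by rewrite -all ler_pM // sumr_ge0.
rewrite [leRHS](bigID P) /= [leRHS]addrC lerD2l -(PE _ (fun t => `|a t|) (fun j => `|b j|)) normrM.
by apply: ler_pM => //; apply: ler_norm_sum.
Qed.

End Correlation.

End Wiener.

(** * The sieve *)

Lemma prime_dvd_prod_seq p (T : seq nat) : prime p -> all prime T ->
  (p %| \prod_(j <- T) j)%N = (p \in T).
Proof.
move=> pp; elim: T => [|j T IH] /=; first by rewrite big_nil dvdn1; case: p pp => [|[]].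
by case/andP=> jp aT; rewrite big_cons Euclid_dvdM // IH // dvdn_prime2 // inE.
Qed.

Lemma prod_primes_gt0 (T : seq nat) : all prime T -> (0 < \prod_(p <- T) p)%N.
Proof.
by elim: T => [|p T IH] /=; rewrite ?big_nil // big_cons muln_gt0 => /andP[/prime_gt0 -> /IH ->].
Qed.

Lemma coprime_prime_prod p (T : seq nat) : prime p -> all prime T -> p \notin T ->
  coprime p (\prod_(j <- T) j).
Proof. by move=> pp aT pT; rewrite prime_coprime // prime_dvd_prod_seq. Qed.

Lemma all_prime_primes m : all prime (primes m).
Proof. by apply/allP => p; rewrite mem_primes => /and3P[]. Qed.

Lemma radn_factor r kr ps : (0 < r)%N -> uniq ps -> all prime ps ->
  radn r = (kr * \prod_(p <- ps) p)%N -> all (fun p => ~~ (p %| kr))%N ps ->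
  perm_eq (primes r) (primes kr ++ ps) /\ kr = (\prod_(p <- primes kr) p)%N.
Proof.
move=> r0 ups aps radr nps; have ps0 := prod_primes_gt0 aps.
have rad0 : (0 < radn r)%N by apply: prod_primes_gt0; apply: all_prime_primes.
have kr0 : (0 < kr)%N by move: rad0; rewrite radr muln_gt0 => /andP[].
have P : perm_eq (primes r) (primes kr ++ ps).
  apply: uniq_perm; first exact: primes_uniq.
    rewrite cat_uniq primes_uniq ups andbT /=; apply/hasPn => p /(allP nps).
    by apply: contra; rewrite mem_primes => /and3P[].
  move=> p; rewrite mem_cat; case: (boolP (prime p)) => [pp|npp]; last first.
    rewrite !mem_primes (negPf npp) /=; apply/esym/negP => /(allP aps).
    by rewrite (negPf npp).
  rewrite -(prime_dvd_prod_seq pp (all_prime_primes r)) -/(radn r) radr Euclid_dvdM //.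
  by rewrite prime_dvd_prod_seq // mem_primes pp kr0.
split=> //; apply/eqP; rewrite -(eqn_pmul2r ps0) -radr -big_cat /=; apply/eqP.
by rewrite /radn (perm_big _ P).
Qed.

Lemma totient_prod_primes (R : numFieldType) (T : seq nat) : uniq T -> all prime T ->
  (totient (\prod_(p <- T) p))%:R / (\prod_(p <- T) p)%N%:R = \prod_(p <- T) (1 - p%:R^-1) :> R.
Proof.
elim: T => [|p T IH] /=; first by rewrite !big_nil divr1.
case/andP=> pT uT /andP[pp aT]; rewrite !big_cons -IH // totient_coprime ?coprime_prime_prod //.
have p0 := prime_gt0 pp; have T0 := prod_primes_gt0 aT.
have p1 : p%:R != 0 :> R by rewrite pnatr_eq0 -lt0n.
have t1 : (\prod_(j <- T) j)%N%:R != 0 :> R by rewrite pnatr_eq0 -lt0n.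
rewrite totient_prime // !natrM -subn1 natrB //; field; by rewrite ?p1 ?t1.
Qed.

(** Each further prime p doubles the list of square-free divisors, by d and p d. *)
Lemma leq_W (T : seq nat) : uniq T -> all prime T -> (2 ^ size T <= W (\prod_(p <- T) p))%N.
Proof.
move=> uT aT; set m := (\prod_(p <- T) p)%N.
have m0 : (0 < m)%N := prod_primes_gt0 aT.
suff [s [us ss sP]] : exists s : seq nat,
    [/\ uniq s, size s = (2 ^ size T)%N & forall d, d \in s -> (d %| m)%N && sqfreeb d].
  rewrite /W -size_filter -ss; apply: uniq_leq_size => // d /sP/andP[dm sd].
  by rewrite mem_filter sd -dvdn_divisors.
rewrite /m {m m0}; elim: T uT aT => [|p T IH] /=.
  by exists [:: 1%N]; split=> // d; rewrite inE => /eqP ->; rewrite dvd1n.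
case/andP=> pT uT /andP[pp aT]; have [s [us ss sP]] := IH uT aT.
have p0 := prime_gt0 pp.
have cop d : d \in s -> ~~ (p %| d)%N.
  move=> /sP/andP[dT _]; apply: contra pT => pd.
  by rewrite -(prime_dvd_prod_seq pp aT) (dvdn_trans pd dT).
exists (s ++ [seq (p * d)%N | d <- s]); split.
- rewrite cat_uniq us map_inj_uniq ?us ?andbT /=.
    by apply/hasPn => d /mapP[e es ->]; apply/negP => /cop; rewrite dvdn_mulr.
  by move=> a b /eqP; rewrite eqn_pmul2l // => /eqP.
- by rewrite size_cat size_map ss expnS mul2n -addnn.
move=> d; rewrite mem_cat big_cons => /orP[/sP/andP[dT ->]|/mapP[e es ->]].
  by rewrite dvdn_mull.
have /andP[eT se] := sP e es; rewrite dvdn_pmul2l // eT /=.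
have e0 : (0 < e)%N by apply: dvdn_gt0 eT; apply: prod_primes_gt0.
apply/allP => j; rewrite mem_primes => /and3P[jp _ jpe].
have [->|jnp] := eqVneq j p; first by rewrite dvdn_pmul2l // cop.
have cjp : coprime (j * j) p.
  by rewrite coprimeMl prime_coprime // dvdn_prime2 // jnp.
rewrite (Gauss_dvdr _ cjp); apply: (allP se); rewrite mem_primes jp e0 /=.
by move: jpe; rewrite Euclid_dvdM // dvdn_prime2 // (negPf jnp).
Qed.

(** Characters live in [algC], the conclusion in an arbitrary [K]. For rational a and b the
    inequality, when a is positive, is equivalent to a^2 <= b^2 q, which both fields share. *)
Lemma ler_ratr_sqrt (K : rcfType) (a b : rat) (q : nat) : 0 <= b ->
  ratr a <= ratr b * sqrtC q%:R :> algC -> ratr a <= ratr b * Num.sqrt q%:R :> K.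
Proof.
move=> b0; have [a0 _|a0 le] := leP a 0.
  by rewrite (le_trans (_ : _ <= 0)) ?lerq0 // mulr_ge0 ?ler0q ?sqrtr_ge0.
have sq : a ^+ 2 <= b ^+ 2 * q%:R.
  rewrite -(ler_rat algC) rmorphXn rmorphM rmorphXn /= ratr_nat -[q%:R]sqrtCK -exprMn.
  have ra : 0 <= ratr a :> algC by rewrite ler0q ltW.
  have rb : 0 <= ratr b * sqrtC q%:R :> algC by rewrite mulr_ge0 ?ler0q ?sqrtC_ge0 ?ler0n.
  exact: lerXn2r.
have ra : 0 <= ratr a :> K by rewrite ler0q ltW.
have rb : 0 <= ratr b * Num.sqrt q%:R :> K by rewrite mulr_ge0 ?ler0q ?sqrtr_ge0.
rewrite -(ler_pXn2r (n := 2)) ?nnegrE //.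
rewrite [in leRHS]exprMn sqr_sqrtr ?ler0n //.
by move: sq; rewrite -(ler_rat K) rmorphXn rmorphM rmorphXn /= ratr_nat.
Qed.

Section Sieve.
Variable F : finFieldType.
Let Q := #|F|.-1.

Definition indb (n : nat) (T : seq nat) (x : F) : bool :=
  [&& x != 0, x ^+ (Q %/ n) == 1 & all (fun p => x ^+ (Q %/ (n * p)) != 1) T].

Lemma indicE n T x : indic n T x = (indb n T x)%:R.
Proof.
rewrite /indic /indb /powind; case: (x != 0) => /=; last by rewrite mul0r.
case: (_ == 1); rewrite /= ?mul0r // mul1r.
elim: T => [|p T IH] /=; first by rewrite big_nil.
by rewrite big_cons IH; case: (_ == 1); rewrite /= ?subr0 ?mul1r // subrr mul0r.
Qed.

(** Where both core indicators are 1, the left side is 1 plus the number of sieving conditions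
    satisfied. This exceeds u + v only if all of them hold, and then by 1. *)
Lemma sieve_pointwise n N T T' ps ls (x y : F) :
  \sum_(p <- ps) indic n (p :: T) x * indic N T' y +
  \sum_(l <- ls) indic n T x * indic N (l :: T') y + indic n T x * indic N T' y
  <= (indb n (T ++ ps) x && indb N (T' ++ ls) y)%:R
     + (size ps + size ls)%N%:R * (indic n T x * indic N T' y).
Proof.
pose c p := x ^+ (Q %/ (n * p)) != 1; pose c' p := y ^+ (Q %/ (N * p)) != 1.
have consE m U p (z : F) : indb m (p :: U) z = indb m U z && (z ^+ (Q %/ (m * p)) != 1).
  by rewrite /indb /= -!andbA; congr (_ && (_ && _)); rewrite andbC.
have catE m U V (z : F) : indb m (U ++ V) z = indb m U z && all (fun p => z ^+ (Q %/ (m * p)) != 1) V.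
  by rewrite /indb all_cat -!andbA.
rewrite !catE !indicE.
under eq_bigr do rewrite !indicE -natrM mulnb consE.
under [X in _ + X + _]eq_bigr do rewrite !indicE -natrM mulnb consE.
rewrite -natrM mulnb.
case: (indb n T x); last by rewrite /= !big1 // !addr0 mulr0 addr0.
case: (indb N T' y); last first.
  by rewrite /= !andbF !big1 ?addr0 ?mulr0 ?addr0 // => p _; rewrite andbF.
rewrite /= mulr1 -!natr_sum -!natrD ler_nat.
have cnt (U : seq nat) (b : pred nat) : (\sum_(p <- U) (b p : nat) = count b U)%N.
  by elim: U => [|p U IH]; rewrite ?big_nil // big_cons IH.
have -> : (\sum_(p <- ps) ((c p && true : bool) : nat) = count c ps)%N.
  by rewrite -cnt; apply: eq_bigr => p _; rewrite andbT.
rewrite cnt.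
have le1 := count_size c ps; have le2 := count_size c' ls.
case: (boolP (all c ps && all c' ls)) => [/andP[]|].
  by rewrite !all_count => /eqP -> /eqP ->; rewrite addnC.
rewrite negb_and !all_count add0n addn1 => /orP[] H.
  by rewrite -addSn leq_add // ltn_neqAle H.
by rewrite -addnS leq_add // ltn_neqAle H.
Qed.

Lemma indic_real n T (x : F) : indic n T x \is Num.real.
Proof. by rewrite indicE realn. Qed.

End Sieve.

Lemma real_normB_le (x y e : algC) : x \is Num.real -> y \is Num.real ->
  `|x - y| <= e -> y - e <= x.
Proof.
move=> xr yr xy; rewrite lerBlDr -lerBlDl; apply: le_trans xy.
by rewrite distrC real_ler_norm // realB.
Qed.

(** * Lower bounds for the sifted counts *)

Section Main.
Variables (F : finFieldType) (E : closedFieldType) (iota : {rmorphism F -> E}).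
Variables (f G : {poly F}) (D : nat) (n N : nat) (T T' ps ls : seq nat).
Let Q := #|F|.-1.
Hypotheses (q5 : (5 <= #|F|)%N) (D1 : (1 <= D)%N).
Hypotheses (nQ : (n %| Q)%N) (NQ : (N %| Q)%N).
Hypotheses (uT : uniq (T ++ ps)) (pT : all prime (T ++ ps)).
Hypotheses (uT' : uniq (T' ++ ls)) (pT' : all prime (T' ++ ls)).
Hypothesis dT : (n * \prod_(p <- T ++ ps) p %| Q)%N.
Hypothesis dT' : (N * \prod_(p <- T' ++ ls) p %| Q)%N.
Hypotheses (sf : (1 < size f)%N) (sG : (1 < size G)%N).
Hypotheses (sqf : sqfree_poly f) (sqG : sqfree_poly G).
Hypothesis nprop : ~ (exists c : F, f = c *: G).
Hypothesis nbr : nb_roots_in_splitting_field (f * G) D.+1.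

Let n0 : (0 < n)%N. Proof. exact: dvdn_gt0 (Qord_gt0 F) nQ. Qed.
Let N0 : (0 < N)%N. Proof. exact: dvdn_gt0 (Qord_gt0 F) NQ. Qed.

Let P : algC := D%:R * sqrtC #|F|%:R.
Let a : algC := n%:R^-1 * \prod_(p <- T) (1 - p%:R^-1).
Let b : algC := N%:R^-1 * \prod_(p <- T') (1 - p%:R^-1).
(** The product of the two l1-norms times D sqrt q. The factor n N only cancels the denominators in
    [a] and [b], so that [a * b] can be factored out at the end. *)
Let X : algC := (n * N * 2 ^ size T * 2 ^ size T')%N%:R * (a * b) * P.
Let corr (n N : nat) (U V : seq nat) : algC := \sum_(x : F) indic n U f.[x] * indic N V G.[x].

(** Since q >= 4, sqrt q >= 2, and D + 1 <= 2 D for D >= 1. *)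
Let P_ge : D.+1%:R <= P.
Proof.
have s2 : 2%:R <= sqrtC #|F|%:R :> algC.
  rewrite -(ler_pXn2r (n := 2)) ?nnegrE ?sqrtC_ge0 ?ler0n // sqrtCK -natrX ler_nat.
  exact: leq_trans q5.
apply: (@le_trans _ _ (D%:R * 2%:R)); last by rewrite ler_wpM2l ?ler0n.
by rewrite -natrM ler_nat; lia.
Qed.

Let P0 : 0 <= P. Proof. by apply: le_trans P_ge; rewrite ler0n. Qed.

Lemma sieve_prod_ge0 (U : seq nat) : all prime U -> 0 <= \prod_(p <- U) (1 - p%:R^-1) :> algC.
Proof.
move=> aU; rewrite big_seq; apply: prodr_ge0 => p pU.
by apply: invn_le1; rewrite prime_gt0 // (allP aU).
Qed.

Lemma prod_two (U : seq nat) :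
  \prod_(p <- U) (2%:R * (1 - p%:R^-1)) = (2 ^ size U)%:R * \prod_(p <- U) (1 - p%:R^-1) :> algC.
Proof.
by rewrite big_split /= big_const_seq count_predT iter_mulr_1 natrX.
Qed.

Lemma dvdn_prod_mem m (U : seq nat) p : (m * \prod_(j <- U) j %| Q)%N -> p \in U -> (m * p %| Q)%N.
Proof.
move=> dU pU; apply: dvdn_trans dU; apply: dvdn_mul => //.
by rewrite (big_rem p) //= dvdn_mulr.
Qed.

Lemma sieve_data m (U us : seq nat) : uniq (U ++ us) -> all prime (U ++ us) ->
  (m * \prod_(p <- U ++ us) p %| Q)%N ->
  [/\ uniq U, all prime U, (m * \prod_(p <- U) p %| Q)%N
    & forall p, p \in us -> [/\ prime p, uniq (p :: U), (m * p %| Q)%N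
                         & (m * \prod_(j <- p :: U) j %| Q)%N]].
Proof.
rewrite cat_uniq all_cat => /and3P[uU Uus uus] /andP[aU aus] dU.
split=> // [|p pus].
  by apply: dvdn_trans dU; rewrite big_cat /= mulnA dvdn_mulr.
have pp := allP aus p pus; split=> //.
- by rewrite /= uU andbT (hasPn Uus).
- by apply: (dvdn_prod_mem dU); rewrite mem_cat pus orbT.
apply: dvdn_trans dU; rewrite dvdn_mul // big_cons big_cat /= mulnC dvdn_mul //.
by rewrite (big_rem p) //= dvdn_mulr.
Qed.

Lemma mean_indic m U : (0 < m)%N -> uniq U -> all prime U -> (m * \prod_(p <- U) p %| Q)%N ->
  (\sum_(x : F) indic m U x) / Q%:R = m%:R^-1 * \prod_(p <- U) (1 - p%:R^-1).
Proof.
move=> m0 uU aU dU; have [chi [chi0 chi1 chiM chi_inj]] := exists_chi F.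
rewrite (sum_indic chi0 chi1 chiM chi_inj) //.
have Q1 : Q%:R != 0 :> algC by rewrite pnatr_eq0 -lt0n Qord_gt0.
have m1 : m%:R != 0 :> algC by rewrite pnatr_eq0 -lt0n.
by field; rewrite ?Q1 ?m1.
Qed.

Lemma wiener_indic_prime m U chi : chi 0 = 0 -> chi 1 = 1 -> {morph chi : x y / x * y} ->
  injective chi -> (0 < m)%N -> (m %| Q)%N -> all prime U -> (m * \prod_(p <- U) p %| Q)%N ->
  @wiener F chi (indic m U) (\prod_(p <- U) (2%:R * (1 - p%:R^-1))).
Proof.
move=> chi0 chi1 chiM chi_inj m0 mQ aU dU.
apply: (wiener_indic chi0 chi1 chiM chi_inj m0 mQ) => p pU.
by rewrite prime_gt0 ?(allP aU) //= (dvdn_prod_mem dU).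
Qed.

Lemma corr_real m M U V : corr m M U V \is Num.real.
Proof. by apply: sum_real => x _; rewrite realM ?indic_real. Qed.

Let a0 : 0 <= a.
Proof.
have [_ aT _ _] := sieve_data uT pT dT.
by rewrite mulr_ge0 ?invr_ge0 ?ler0n // sieve_prod_ge0.
Qed.

Let b0 : 0 <= b.
Proof.
have [_ aT' _ _] := sieve_data uT' pT' dT'.
by rewrite mulr_ge0 ?invr_ge0 ?ler0n // sieve_prod_ge0.
Qed.

Let XE : X = \prod_(p <- T) (2%:R * (1 - p%:R^-1)) * \prod_(p <- T') (2%:R * (1 - p%:R^-1)) * P.
Proof.
have n1 : n%:R != 0 :> algC by rewrite pnatr_eq0 -lt0n.
have N1 : N%:R != 0 :> algC by rewrite pnatr_eq0 -lt0n.
by rewrite !prod_two /X /a /b !natrM; field; rewrite n1 N1.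
Qed.

(** The main term counts only the points where f G != 0, losing at most a b (D + 1); the error of
    [wiener_correlation] falls short of [X] by a b D sqrt q, which is at least as much. *)
Lemma corr_main : a * b * #|F|%:R - X <= corr n N T T'.
Proof.
have [chi [chi0 chi1 chiM chi_inj]] := exists_chi F.
have [uT1 aT1 dT1 _] := sieve_data uT pT dT.
have [uT2 aT2 dT2 _] := sieve_data uT' pT' dT'.
have w1 := wiener_indic_prime chi0 chi1 chiM chi_inj n0 nQ aT1 dT1.
have w2 := wiener_indic_prime chi0 chi1 chiM chi_inj N0 NQ aT2 dT2.
have := wiener_correlation chi0 chi1 chiM chi_inj iota sf sG sqf sqG nprop nbr w1 w2.
rewrite /= !mean_indic // -/a -/b -/P (ger0_norm (mulr_ge0 a0 b0)) mulrBl -XE.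
have abr : a * b * (nonzeros f G)%:R \is Num.real by apply: ger0_real; rewrite (mulr_ge0 (mulr_ge0 a0 b0)) ?ler0n.
move/(real_normB_le (corr_real n N T T') abr); apply: le_trans.
rewrite opprB addrA lerD2r -mulrDr (ler_wpM2l (mulr_ge0 a0 b0)) //.
have := card_roots_le iota sf sG sqf sqG nbr.
have : (#|[set x : F | root (f * G) x]| + nonzeros f G = #|F|)%N.
  rewrite /nonzeros -(cardsC [set x : F | root (f * G) x]); congr (_ + _)%N.
  by apply: eq_card => x; rewrite !inE.
move=> <- rD; rewrite natrD addrC lerD2l; apply: le_trans P_ge.
by rewrite ler_nat.
Qed.

Lemma corr_sieve_left p : p \in ps ->
  (1 - p%:R^-1) * (corr n N T T' - X) <= corr n N (p :: T) T'.
Proof.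
move=> pps; have [chi [chi0 chi1 chiM chi_inj]] := exists_chi F.
have [uT1 aT1 dT1 /(_ p pps)[pp upT npQ dpT]] := sieve_data uT pT dT.
have [uT2 aT2 dT2 _] := sieve_data uT' pT' dT'.
have w1 : @wiener F chi (fun x => indic n (p :: T) x - (1 - p%:R^-1) * indic n T x)
    (\prod_(p <- T) (2%:R * (1 - p%:R^-1)) * (1 - p%:R^-1)).
  apply: (wiener_indic_sub chi0 chi1 chiM chi_inj n0 nQ (prime_gt0 pp) npQ) => j jT.
  by rewrite prime_gt0 ?(allP aT1) //= (dvdn_prod_mem dT1).
have w2 := wiener_indic_prime chi0 chi1 chiM chi_inj N0 NQ aT2 dT2.
have := wiener_correlation chi0 chi1 chiM chi_inj iota sf sG sqf sqG nprop nbr w1 w2.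
have m0 : (\sum_(x : F) (indic n (p :: T) x - (1 - p%:R^-1) * indic n T x)) / Q%:R = 0.
  rewrite sumrB -mulr_sumr mulrBl -mulrA !mean_indic //=; last by rewrite pp.
  by rewrite big_cons; ring.
rewrite /= m0 !mul0r normr0 !subr0.
have -> : \sum_x (indic n (p :: T) f.[x] - (1 - p%:R^-1) * indic n T f.[x]) * indic N T' G.[x]
   = corr n N (p :: T) T' - (1 - p%:R^-1) * corr n N T T'.
  by rewrite /corr mulr_sumr -sumrB; apply: eq_bigr => x _; ring.
set A := \prod_(j <- T) _; set B := \prod_(j <- T') _.
have -> : A * (1 - p%:R^-1) * B * (D%:R * sqrtC #|F|%:R) = (1 - p%:R^-1) * X.
  by rewrite XE -/A -/B -/P; ring.
rewrite mulrBr; apply: real_normB_le; first exact: corr_real.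
by rewrite realM ?corr_real // ger0_real // invn_le1 // prime_gt0.
Qed.

Lemma corr_sieve_right l : l \in ls ->
  (1 - l%:R^-1) * (corr n N T T' - X) <= corr n N T (l :: T').
Proof.
move=> lls; have [chi [chi0 chi1 chiM chi_inj]] := exists_chi F.
have [uT1 aT1 dT1 _] := sieve_data uT pT dT.
have [uT2 aT2 dT2 /(_ l lls)[lp ulT NlQ dlT]] := sieve_data uT' pT' dT'.
have w1 := wiener_indic_prime chi0 chi1 chiM chi_inj n0 nQ aT1 dT1.
have w2 : @wiener F chi (fun x => indic N (l :: T') x - (1 - l%:R^-1) * indic N T' x)
    (\prod_(p <- T') (2%:R * (1 - p%:R^-1)) * (1 - l%:R^-1)).
  apply: (wiener_indic_sub chi0 chi1 chiM chi_inj N0 NQ (prime_gt0 lp) NlQ) => j jT.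
  by rewrite prime_gt0 ?(allP aT2) //= (dvdn_prod_mem dT2).
have := wiener_correlation chi0 chi1 chiM chi_inj iota sf sG sqf sqG nprop nbr w1 w2.
have m0 : (\sum_(x : F) (indic N (l :: T') x - (1 - l%:R^-1) * indic N T' x)) / Q%:R = 0.
  rewrite sumrB -mulr_sumr mulrBl -mulrA !mean_indic //=; last by rewrite lp.
  by rewrite big_cons; ring.
rewrite /= m0 mulr0 mul0r normr0 !subr0.
have -> : \sum_x indic n T f.[x] * (indic N (l :: T') G.[x] - (1 - l%:R^-1) * indic N T' G.[x])
   = corr n N T (l :: T') - (1 - l%:R^-1) * corr n N T T'.
  by rewrite /corr mulr_sumr -sumrB; apply: eq_bigr => x _; ring.
set A := \prod_(j <- T) _; set B := \prod_(j <- T') _.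
have -> : A * (B * (1 - l%:R^-1)) * (D%:R * sqrtC #|F|%:R) = (1 - l%:R^-1) * X.
  by rewrite XE -/A -/B -/P; ring.
rewrite mulrBr; apply: real_normB_le; first exact: corr_real.
by rewrite realM ?corr_real // ger0_real // invn_le1 // prime_gt0.
Qed.

Lemma sieve_count :
  \sum_(p <- ps) corr n N (p :: T) T' + \sum_(l <- ls) corr n N T (l :: T') + corr n N T T'
  <= (\sum_(x : F) (indb n (T ++ ps) f.[x] && indb N (T' ++ ls) G.[x]))%N%:R
     + (size ps + size ls)%N%:R * corr n N T T'.
Proof.
rewrite /corr natr_sum mulr_sumr -big_split /=.
rewrite exchange_big [X in _ + X + _]exchange_big /= -!big_split /=.
by apply: ler_sum => x _; apply: sieve_pointwise.
Qed.

(** The factors 1 - 1/p and 1 - 1/l add up to u + v - 1 + delta, so the sieve gives delta c - (u + v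
    - 1 + delta) X with c the core count. Inserting c >= a b q - X costs another delta X, whence (u
    + v - 1) / delta + 2 after division by delta. *)
Theorem sieve_bound (delta : algC) :
  delta = 1 - \sum_(p <- ps) p%:R^-1 - \sum_(l <- ls) l%:R^-1 -> 0 <= delta ->
  delta * (a * b) * #|F|%:R - ((size ps + size ls)%N%:R - 1 + 2%:R * delta) * X
  <= (\sum_(x : F) (indb n (T ++ ps) f.[x] && indb N (T' ++ ls) G.[x]))%N%:R.
Proof.
move=> dE d0; have := sieve_count; set c := corr n N T T'; rewrite -lerBlDr; apply: le_trans.
have sumB (us : seq nat) : \sum_(p <- us) (1 - p%:R^-1) = (size us)%:R - \sum_(p <- us) p%:R^-1 :> algC.
  by rewrite sumrB big_const_seq count_predT iter_addr_0.
have L : \sum_(p <- ps) (1 - p%:R^-1) * (c - X) <= \sum_(p <- ps) corr n N (p :: T) T'.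
  by rewrite !big_seq; apply: ler_sum => p; apply: corr_sieve_left.
have R : \sum_(l <- ls) (1 - l%:R^-1) * (c - X) <= \sum_(l <- ls) corr n N T (l :: T').
  by rewrite !big_seq; apply: ler_sum => l; apply: corr_sieve_right.
apply: le_trans (lerB (lerD (lerD L R) (lexx c)) (lexx _)).
rewrite -!mulr_suml !sumB.
have := ler_wpM2l d0 corr_main; rewrite -/c -subr_ge0 => H; rewrite -subr_ge0.
apply: le_trans H _; rewrite le_eqVlt; apply/orP; left; apply/eqP.
by rewrite dE natrD; ring.
Qed.

End Main.

(** * Assembly of the bound over a real closed field *)

Lemma prod_primes_dvd (U : seq nat) m : uniq U -> all prime U -> all (fun p => p %| m)%N U ->
  (\prod_(p <- U) p %| m)%N.
Proof.
elim: U => [|p U IH] /=; first by rewrite big_nil dvd1n.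
case/andP=> pU uU /andP[pp aU] /andP[pm dU].
by rewrite big_cons Gauss_dvd ?coprime_prime_prod // pm IH.
Qed.

Lemma sieve_modulus_dvd (Q n r kr : nat) ps : (n %| Q)%N -> (r %| Q %/ n)%N -> (0 < r)%N ->
  perm_eq (primes r) (primes kr ++ ps) -> (n * \prod_(p <- primes kr ++ ps) p %| Q)%N.
Proof.
move=> nQ rQ r0 P; rewrite -(perm_big _ P) /= -(divnK nQ) mulnC dvdn_mul //.
apply: dvdn_trans rQ; apply: prod_primes_dvd; rewrite ?primes_uniq ?all_prime_primes //.
by apply/allP => p; rewrite mem_primes => /and3P[].
Qed.

Lemma rn_free_indb (F : finFieldType) (n r : nat) (U : seq nat) (x : F) :
  (0 < n)%N -> (n %| #|F|.-1)%N -> (r %| #|F|.-1 %/ n)%N -> perm_eq (primes r) U ->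
  rn_free r n x = indb n U x.
Proof. by move=> n0 nQ rQ P; rewrite rn_freeP // /indb -(perm_all _ P). Qed.

Theorem theorem4p6 (F : finFieldType) (n N r R : nat) (f G : {poly F}) (D : nat)
    (ps ls : seq nat) (kr kR : nat) (K : rcfType) :
  (5 <= #|F|)%N ->
  (n %| #|F|.-1)%N -> (N %| #|F|.-1)%N ->
  (r %| #|F|.-1 %/ n)%N -> (R %| #|F|.-1 %/ N)%N ->
  (1 < size f)%N -> (1 < size G)%N -> sqfree_poly f -> sqfree_poly G ->
  ~ (exists c : F, f = c *: G) ->
  nb_roots_in_splitting_field (f * G) D.+1 ->
  (1 <= D)%N ->
  uniq ps -> all prime ps -> all (fun p => p %| r)%N ps ->
  uniq ls -> all prime ls -> all (fun l => l %| R)%N ls ->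
  radn r = (kr * \prod_(p <- ps) p)%N -> all (fun p => ~~ (p %| kr))%N ps ->
  radn R = (kR * \prod_(l <- ls) l)%N -> all (fun l => ~~ (l %| kR))%N ls ->
  let delta : K := 1 - \sum_(p <- ps) (p%:R)^-1 - \sum_(l <- ls) (l%:R)^-1 in
  0 < delta ->
  delta * ((totient kr * totient kR)%N%:R / (kr * n * kR * N)%N%:R)
    * (#|F|%:R - (D * n * N * W kr * W kR)%N%:R
         * (((size ps + size ls)%N%:R - 1) / delta + 2) * Num.sqrt (#|F|%:R))
  <= (NfF r n R N f G)%:R.
Proof.
move=> q5 nQ NQ rQ RQ sf sG sqf sqG nprop nbr D1 ups aps _ uls als _ radr nps radR nls delta d0.
have [E [iota _]] := countable_algebraic_closure F.
have Q0 := Qord_gt0 F.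
have n0 : (0 < n)%N by apply: dvdn_gt0 nQ.
have N0 : (0 < N)%N by apply: dvdn_gt0 NQ.
have r0 : (0 < r)%N by apply: dvdn_gt0 rQ; rewrite divn_gt0 // dvdn_leq.
have R0 : (0 < R)%N by apply: dvdn_gt0 RQ; rewrite divn_gt0 // dvdn_leq.
have [Pr krE] := radn_factor r0 ups aps radr nps.
have [PR kRE] := radn_factor R0 uls als radR nls.
have dT := sieve_modulus_dvd nQ rQ r0 Pr.
have dT' := sieve_modulus_dvd NQ RQ R0 PR.
have uT : uniq (primes kr ++ ps) by rewrite -(perm_uniq Pr) primes_uniq.
have uT' : uniq (primes kR ++ ls) by rewrite -(perm_uniq PR) primes_uniq.
have pT : all prime (primes kr ++ ps) by rewrite -(perm_all _ Pr) all_prime_primes.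
have pT' : all prime (primes kR ++ ls) by rewrite -(perm_all _ PR) all_prime_primes.
(* delta, kappa and the error factor are taken in [rat], to be read both in [algC] and in [K]. *)
pose dq : rat := 1 - \sum_(p <- ps) p%:R^-1 - \sum_(l <- ls) l%:R^-1.
have ratr_dq (k : numFieldType) :
    ratr dq = 1 - \sum_(p <- ps) p%:R^-1 - \sum_(l <- ls) l%:R^-1 :> k.
  rewrite !rmorphB rmorph1 !rmorph_sum /=.
  by congr (_ - _ - _); apply: eq_bigr => p _; rewrite fmorphV rmorph_nat.
have dq0 : 0 < dq by rewrite -(ltr0q K) ratr_dq.
have countE : NfF r n R N f G =
    (\sum_(x : F) (indb n (primes kr ++ ps) f.[x] && indb N (primes kR ++ ls) G.[x]))%N.
  rewrite /NfF -sum1_card big_mkcond /=; apply: eq_bigr => x _.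
  rewrite inE (rn_free_indb _ n0 nQ rQ Pr) (rn_free_indb _ N0 NQ RQ PR).
  by case: (_ && _).
have kr0 : (0 < kr)%N by rewrite krE prod_primes_gt0 ?all_prime_primes.
have kR0 : (0 < kR)%N by rewrite kRE prod_primes_gt0 ?all_prime_primes.
pose kap : rat := (totient kr * totient kR)%N%:R / (kr * n * kR * N)%N%:R.
have kap0 : 0 <= kap by rewrite divr_ge0 ?ler0n.
pose M := (D * n * N * W kr * W kR)%N.
pose c : rat := (size ps + size ls)%N%:R - 1 + 2%:R * dq.
have c0 : 0 <= c.
  (* Without sieving primes delta = 1 and c = 1; otherwise u + v - 1 >= 0. *)
  rewrite /c; case: (posnP (size ps + size ls)) => [/eqP|s0].
    rewrite addn_eq0 !size_eq0 => /andP[/eqP ps0 /eqP ls0].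
    by rewrite /dq ps0 ls0 !big_nil !subr0 mulr1 /=.
  by rewrite addr_ge0 ?mulr_ge0 ?(ltW dq0) // subr_ge0 ler1n.
have ratr_kap (k : numFieldType) :
    ratr kap = (totient kr * totient kR)%N%:R / (kr * n * kR * N)%N%:R :> k.
  by rewrite /kap fmorph_div !rmorph_nat.
have tot m : m = (\prod_(p <- primes m) p)%N ->
    (totient m)%:R / m%:R = \prod_(p <- primes m) (1 - p%:R^-1) :> algC.
  by move=> mE; rewrite {1 2}mE totient_prod_primes ?primes_uniq ?all_prime_primes.
have kapE : n%:R^-1 * \prod_(p <- primes kr) (1 - p%:R^-1) *
    (N%:R^-1 * \prod_(p <- primes kR) (1 - p%:R^-1)) = ratr kap :> algC.
  rewrite -!tot // ratr_kap !natrM.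
  have nz m : (0 < m)%N -> m%:R != 0 :> algC by rewrite pnatr_eq0 -lt0n.
  by field; rewrite !nz.
have := @sieve_bound F E iota f G D n N (primes kr) (primes kR) ps ls q5 D1 nQ NQ uT pT uT' pT'
  dT dT' sf sG sqf sqG nprop nbr (ratr dq) (ratr_dq _).
rewrite kapE -countE ler0q (ltW dq0) => /(_ isT) bound.
have Wr : (2 ^ size (primes kr) <= W kr)%N.
  by rewrite {2}krE leq_W ?primes_uniq ?all_prime_primes.
have WR : (2 ^ size (primes kR) <= W kR)%N.
  by rewrite {2}kRE leq_W ?primes_uniq ?all_prime_primes.
set q := #|F| in q5 nQ NQ rQ RQ Q0 dT dT' bound *.
have ratr_c (k : numFieldType) :
    ratr c = (size ps + size ls)%N%:R - 1 + 2%:R * ratr dq :> k.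
  by rewrite rmorphD rmorphB rmorphM rmorph1 /= !rmorph_nat.
have ME : (n * N * 2 ^ size (primes kr) * 2 ^ size (primes kR) * D <= M)%N.
  have -> : M = (n * N * W kr * W kR * D)%N by rewrite /M; ring.
  by rewrite !leq_mul.
have dE : delta = ratr dq by rewrite ratr_dq.
rewrite /= -ratr_kap -/M dE.
rewrite -ratr_c in bound.
clearbody kap c M dq.
(* The claim becomes aq <= bq sqrt q with rational aq and bq, the form in which it passes from
   [algC] to [K]. *)
pose aq : rat := dq * kap * q%:R - (NfF r n R N f G)%:R.
pose bq : rat := c * (M%:R * kap).
have bq0 : 0 <= bq by apply: mulr_ge0 => //; apply: mulr_ge0; rewrite ?ler0n.
have aqE (k : numFieldType) : ratr aq = ratr dq * ratr kap * q%:R - (NfF r n R N f G)%:R :> k.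
  by rewrite rmorphB !rmorphM /= !rmorph_nat.
have bqE (k : numFieldType) : ratr bq = ratr c * (M%:R * ratr kap) :> k.
  by rewrite !rmorphM /= rmorph_nat.
have : ratr aq <= ratr bq * sqrtC q%:R :> algC.
  rewrite aqE bqE lerBlDr -lerBlDl; apply: le_trans bound.
  rewrite lerD2l lerN2 -[leRHS]mulrA ler_wpM2l ?ler0q //.
  have -> : (n * N * 2 ^ size (primes kr) * 2 ^ size (primes kR))%N%:R * ratr kap * (D%:R * sqrtC q%:R)
      = (n * N * 2 ^ size (primes kr) * 2 ^ size (primes kR) * D)%N%:R * ratr kap * sqrtC q%:R :> algC.
    by rewrite (natrM _ _ D); ring.
  by rewrite ler_wpM2r ?sqrtC_ge0 ?ler0n // ler_wpM2r ?ler0q // ler_nat.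
move/(ler_ratr_sqrt K bq0); rewrite aqE bqE -subr_ge0 => H; rewrite -subr_ge0.
apply: (le_trans H); rewrite le_eqVlt; apply/orP; left; apply/eqP.
have dn0 : ratr dq != 0 :> K by rewrite gt_eqF // ltr0q.
rewrite ratr_c; field.
by rewrite dn0.
Qed.
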